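(* Every infinite dimensional Hilbert space $H$ contains three closed subspaces $X_1, X_2, X_3$ with the following property. For every $0\neq w_0\in H$ there is a sequence $k_1,k_2,\dots\in\{1,2,3\}$ such that the sequence of iterates $\{w_n\}_{n=1}^\infty$ defined by $w_n=X_{k_n}w_{n-1}$ for $n\ge 1$ does not converge in norm.
   Context: For a closed subspace $X$ of a Hilbert space $H$, the same symbol $X$ also denotes the orthogonal projection of $H$ onto $X$; thus $X_{k_n}w_{n-1}$ is the orthogonal projection of $w_{n-1}$ onto the subspace $X_{k_n}$. *)

(* Defs.v *)
From HB Require Import structures.
From mathcomp Require Export all_boot all_order all_algebra.
From mathcomp Require Export sesquilinear.
From mathcomp Require Export all_classical all_reals all_analysis.
From mathcomp Require Export complex.

Set Implicit Arguments.
Unset Strict Implicit.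
Unset Printing Implicit Defensive.

Import Order.TTheory GRing.Theory Num.Theory.
Import numFieldNormedType.Exports.

Local Open Scope classical_set_scope.
Local Open Scope ring_scope.

(* A Hilbert space is a complete normed module whose norm is the one induced by
   an inner product [ip] (linear in its first argument, [theta]-linear in the
   second): [theta] is [idfun] over the reals and [Num.conj] over the complex
   numbers. *)
Definition induces_norm (K : numFieldType) (theta : K -> K)
    (H : completeNormedModType K) (ip : {dot H for theta}) : Prop :=
  forall x : H, ip x x = `|x| ^+ 2.

Definition finite_dimensional (K : numFieldType) (H : lmodType K) : Prop :=
  exists (n : nat) (e : 'I_n -> H),
    forall x : H, exists c : 'I_n -> K, x = \sum_(i < n) c i *: e i.

Definition closed_subspace (K : numFieldType) (H : completeNormedModType K)
    (X : set H) : Prop :=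
  submod_closed [in X] /\ closed X.

(* When [X] is a closed subspace of a Hilbert space, the point described below
   exists and is unique, so the default value [0] plays no role. *)
Definition orth_proj (K : numFieldType) (theta : K -> K)
    (H : completeNormedModType K) (ip : {dot H for theta}) (X : set H) (x : H)
    : H :=
  xget 0 [set p : H | X p /\ forall y : H, X y -> ip (x - p) y = 0].

(* The value [k 0] is not used: [k 1, k 2, ...] is the sequence of indices. *)
Fixpoint iterates (K : numFieldType) (theta : K -> K)
    (H : completeNormedModType K) (ip : {dot H for theta})
    (X : 'I_3 -> set H) (k : nat -> 'I_3) (w0 : H) (n : nat) : H :=
  if n is m.+1 then orth_proj ip (X (k n)) (iterates ip X k w0 m) else w0.

(* Main.v *)
From HB Require Import structures.
Require Import Defs.
From mathcomp Require Import lra ring.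

Set Implicit Arguments.
Unset Strict Implicit.
Unset Printing Implicit Defensive.

Import Order.TTheory GRing.Theory Num.Theory.
Import numFieldNormedType.Exports.

Local Open Scope classical_set_scope.
Local Open Scope ring_scope.
Local Open Scope complex_scope.

(** Along an orthonormal sequence e_0, e_1, e_2, ... three subspaces are built
such that, for every n, some product of the three projections moves e_n to
within a summable error of e_(n+1).  Concatenating these products, the iterates
of e_0 keep a norm close to 1 and pass through one orthogonal direction after
another, so they are not Cauchy ([orbit_not_cauchy]).

One quarter turn ([quarter_turn]).  Let u = e_n and v = e_(n+1), and let
h_0 = u, ..., h_k = v be unit vectors of their plane with steps so small that
projecting successively onto the lines of h_1, ..., h_k hardly shortens u
([slow_path]).  Let g_i be the unit vector of the plane orthogonal to h_(i+1),
and let z_i, w_i be auxiliary orthonormal vectors.  Put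
  X = span(u, v),   S = span(u, v, z_0, ..., z_(k-1)),
  Y = vectors x with w_i-coordinate equal to t_i <x, z_i - b_i g_i> for all i.
By von Neumann's theorem ([alternating_projections]) the powers of SYS tend to
the projection onto the intersection of S and Y.  If t_0 >> t_1 >> ..., they do
so one constraint at a time: some power of SYS has already enforced the
constraints i <= j while it does not yet notice the others, so it is close to
the projection L_j onto the vectors of S with z_i-coordinate b_i <x, g_i> for
i <= j ([chain_power]).  One level up, the powers of X L_j X tend to the
projection onto the intersection of X and L_j, and if b_i << b_j for i < j, some
power sees only the constraint j, that is, it is close to the projection onto
the line of h_(j+1) ([line_power]).  In the resulting word the number of letters
X depends on the b_i but not on the t_i.

The chain of turns ([proj_near_ideal], [turning_parameters]).  In the blocks
{e_n, e_(n+1), z_(n,i), w_(n,i)} with n even, the three subspaces play the roles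
X, S, Y; with n odd they play the roles Y, X, S.  Consecutive blocks share a
vector e, and this disturbs only one role: X in even blocks and S in odd ones,
by an amount controlled by the t of the two neighbouring blocks.  In even blocks
this is harmless, because the number of letters X is known before any t is
chosen; the t of the odd blocks are chosen accordingly, and they determine the
words there; finally the t of the even blocks are chosen small with respect to
the lengths of those words.

All vectors ([invariant_trivial], [stable_perp_family]).  The vectors all of
whose sequences of iterates are Cauchy form a closed subspace invariant under
the three projections, hence the projection Pi onto it commutes with them.  The
intersection of the first two subspaces is the line of e_0, so Pi e_0 is a
multiple of e_0, and it vanishes since e_0 has a divergent sequence.  As the
numbers t_(n,i) are pairwise distinct, commutation makes z_(n,i), w_(n,i) and
g_(n,i) eigenvectors of Pi for a common eigenvalue; starting from e_0 this
forces Pi e_n = 0 for all n and then Pi = 0.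

The whole space ([total_orthofam], [three_subspaces]).  Zorn's lemma provides a
maximal set of mutually orthogonal orthonormal families, each labelled like one
chain.  What is left over is finite dimensional and is absorbed at the beginning
of the sequence e of one family.  The three subspaces are the orthogonal
complements of all the constraints of all the chains.  Complex spaces are
treated as real ones, with the real part of the inner product: for a complex
subspace this gives the same orthogonal projection. *)


(** * Real Hilbert spaces and orthogonal projections *)

Section RealHilbert.
Variable R : realType.

(** Completeness is spelled out with square roots because the norm is only
defined from the inner product afterwards. *)
Structure hilbert (H : lmodType R) := Hilbert {
  dot :> H -> H -> R;
  dotC : forall x y, dot x y = dot y x;
  dotDl : forall x y z, dot (x + y) z = dot x z + dot y z;
  dotZl : forall a x y, dot (a *: x) y = a * dot x y;
  dot_ge0 : forall x, 0 <= dot x x;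
  dot_eq0 : forall x, dot x x = 0 -> x = 0;
  dot_complete : forall u : nat -> H,
    (forall e : R, 0 < e -> exists n0, forall m n, (n0 <= m)%N -> (n0 <= n)%N ->
       Num.sqrt (dot (u m - u n) (u m - u n)) < e) ->
    exists x, forall e : R, 0 < e -> exists n0, forall n, (n0 <= n)%N ->
       Num.sqrt (dot (u n - x) (u n - x)) < e }.

Variables (H : lmodType R) (D : hilbert H).
Implicit Types (x y z : H) (M N F : set H).

Lemma dotDr x y z : D z (x + y) = D z x + D z y.
Proof. by rewrite dotC dotDl !(dotC _ z). Qed.
Lemma dotZr a x y : D x (a *: y) = a * D x y.
Proof. by rewrite dotC dotZl dotC. Qed.
Lemma dotNl x y : D (- x) y = - D x y.
Proof. by rewrite -scaleN1r dotZl mulN1r. Qed.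
Lemma dotNr x y : D x (- y) = - D x y.
Proof. by rewrite dotC dotNl dotC. Qed.
Lemma dotBl x y z : D (x - y) z = D x z - D y z.
Proof. by rewrite dotDl dotNl. Qed.
Lemma dotBr x y z : D z (x - y) = D z x - D z y.
Proof. by rewrite dotDr dotNr. Qed.
Lemma dot0l x : D 0 x = 0.
Proof. by rewrite -(scale0r 0) dotZl mul0r. Qed.
Lemma dot0r x : D x 0 = 0.
Proof. by rewrite dotC dot0l. Qed.
Lemma dot_suml (I : Type) (r : seq I) (P : pred I) (f : I -> H) y :
  D (\sum_(i <- r | P i) f i) y = \sum_(i <- r | P i) D (f i) y.
Proof.
by elim/big_rec2: _ => [|i a b _ <-]; rewrite ?dot0l ?dotDl.
Qed.
Lemma dot_sumr (I : Type) (r : seq I) (P : pred I) (f : I -> H) y :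
  D y (\sum_(i <- r | P i) f i) = \sum_(i <- r | P i) D y (f i).
Proof.
by rewrite dotC dot_suml; apply: eq_bigr => i _; rewrite dotC.
Qed.

Definition dotE := (dotDl, dotDr, dotBl, dotBr, dotNl, dotNr, dotZl, dotZr,
  dot0l, dot0r).

Definition nrm x : R := Num.sqrt (D x x).

Lemma nrm_ge0 x : 0 <= nrm x. Proof. exact: sqrtr_ge0. Qed.
Lemma nrm_sqr x : nrm x ^+ 2 = D x x.
Proof. by rewrite sqr_sqrtr // dot_ge0. Qed.
Lemma nrm0 : nrm 0 = 0. Proof. by rewrite /nrm dot0l sqrtr0. Qed.
Lemma nrm1 x : D x x = 1 -> nrm x = 1.
Proof. by rewrite /nrm => ->; rewrite sqrtr1. Qed.
Lemma nrm_eq0 x : nrm x = 0 -> x = 0.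
Proof. by move=> h; apply: (@dot_eq0 _ D); rewrite -nrm_sqr h expr0n. Qed.
Lemma nrmZ a x : nrm (a *: x) = `|a| * nrm x.
Proof.
by rewrite /nrm dotZl dotZr mulrA -expr2 sqrtrM ?sqr_ge0// sqrtr_sqr.
Qed.
Lemma nrmN x : nrm (- x) = nrm x.
Proof. by rewrite -scaleN1r nrmZ normrN1 mul1r. Qed.
Lemma nrmB x y : nrm (x - y) = nrm (y - x).
Proof. by rewrite -nrmN opprB. Qed.

Lemma cauchy_schwarz x y : `|D x y| <= nrm x * nrm y.
Proof.
rewrite -(ler_pXn2r (n := 2)) ?nnegrE ?normr_ge0 ?mulr_ge0 ?nrm_ge0//.
rewrite real_normK ?num_real// exprMn !nrm_sqr.
have [y0|y0] := eqVneq (D y y) 0.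
  by rewrite (dot_eq0 y0) !dot0r mulr0 expr0n.
have yp : 0 < D y y by rewrite lt_neqAle eq_sym y0 dot_ge0.
have := dot_ge0 D (D y y *: x - D x y *: y).
rewrite !dotE (dotC D y x) => h.
have : 0 <= D y y * (D x x * D y y - D x y ^+ 2) by nra.
by rewrite pmulr_rge0// subr_ge0.
Qed.

Lemma nrmD x y : nrm (x + y) <= nrm x + nrm y.
Proof.
rewrite -(ler_pXn2r (n := 2)) ?nnegrE ?addr_ge0 ?nrm_ge0//.
rewrite sqrrD !nrm_sqr !dotE (dotC D y x).
have := cauchy_schwarz x y; have := ler_norm (D x y).
by move=> h1 h2; lra.
Qed.

Lemma nrm_dist x y z : nrm (x - z) <= nrm (x - y) + nrm (y - z).
Proof. by rewrite -[x - z](subrKA y) nrmD. Qed.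

Lemma nrm_sum (I : Type) (r : seq I) (P : pred I) (f : I -> H) :
  nrm (\sum_(i <- r | P i) f i) <= \sum_(i <- r | P i) nrm (f i).
Proof.
elim/big_rec2: _ => [|i a b _ h]; first by rewrite nrm0.
by rewrite (le_trans (nrmD _ _))// lerD2l.
Qed.

Lemma nrm_le_dot x c : 0 <= c -> D x x <= c ^+ 2 -> nrm x <= c.
Proof.
by move=> c0 h; rewrite -(ler_pXn2r (n := 2)) ?nnegrE ?nrm_ge0 ?nrm_sqr.
Qed.

Definition tends (u : nat -> H) x :=
  forall e : R, 0 < e -> exists n0, forall n, (n0 <= n)%N -> nrm (u n - x) < e.

Definition is_cauchy (u : nat -> H) :=
  forall e : R, 0 < e -> exists n0, forall m n, (n0 <= m)%N -> (n0 <= n)%N ->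
    nrm (u m - u n) < e.

Lemma tends_is_cauchy u x : tends u x -> is_cauchy u.
Proof.
move=> ux e e0; have [|n0 h] := ux (e / 2); first by rewrite divr_gt0.
exists n0 => m n hm hn; rewrite (le_lt_trans (nrm_dist _ x _))//.
by rewrite [e]splitr ltrD ?h// nrmB h.
Qed.

Lemma tends_dot u x y c : tends u x -> (forall n, D (u n) y = c) -> D x y = c.
Proof.
move=> ux h; apply/eqP; rewrite -subr_eq0 -normr_eq0; apply/eqP.
apply/le_anti; rewrite normr_ge0 andbT; apply/ler_addgt0Pr => e e0.
rewrite add0r; have y1 : 0 < nrm y + 1 by rewrite ltr_wpDl ?nrm_ge0.
have [n0 hn] := ux (e / (nrm y + 1)) (divr_gt0 e0 y1).
rewrite -(h n0) distrC -dotBl (le_trans (cauchy_schwarz _ _))//.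
have := hn n0 (leqnn _); rewrite ltr_pdivlMr// => h1.
by have := nrm_ge0 (u n0 - x); have := nrm_ge0 y => *; nra.
Qed.

Lemma tends_uniq u x y : tends u x -> tends u y -> x = y.
Proof.
move=> ux uy; apply/eqP; rewrite -subr_eq0; apply/eqP/nrm_eq0.
apply/le_anti; rewrite nrm_ge0 andbT; apply/ler_addgt0Pr => e e0.
have e2 : 0 < e / 2 by rewrite divr_gt0.
have [n0 h0] := ux _ e2; have [n1 h1] := uy _ e2.
rewrite add0r (le_trans (nrm_dist _ (u (maxn n0 n1)) _))//.
rewrite [e]splitr lerD// ?[nrm (x - _)]nrmB ltW// ?h0 ?h1//.
  by rewrite leq_maxl.
by rewrite leq_maxr.
Qed.

(** Closed linear subspaces; closedness is sequential. *)
Record csub M : Prop := Csub {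
  csub0 : M 0;
  csubL : forall a x y, M x -> M y -> M (a *: x + y);
  csub_lim : forall u x, (forall n, M (u n)) -> tends u x -> M x }.

Lemma csubD M x y : csub M -> M x -> M y -> M (x + y).
Proof. by move=> hM hx hy; rewrite -[x]scale1r; apply: csubL. Qed.
Lemma csubZ M a x : csub M -> M x -> M (a *: x).
Proof. by move=> hM hx; rewrite -[_ *: _]addr0; apply: csubL => //; apply: csub0. Qed.
Lemma csubN M x : csub M -> M x -> M (- x).
Proof. by rewrite -scaleN1r; apply: csubZ. Qed.
Lemma csubB M x y : csub M -> M x -> M y -> M (x - y).
Proof. by move=> hM hx hy; apply: csubD => //; apply: csubN. Qed.
Lemma csub_sum M (I : Type) (r : seq I) (P : pred I) (f : I -> H) :
  csub M -> (forall i, P i -> M (f i)) -> M (\sum_(i <- r | P i) f i).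
Proof.
move=> hM h; elim/big_ind: _ => //; first exact: csub0.
by move=> *; apply: csubD.
Qed.

Lemma csubI M N : csub M -> csub N -> csub (M `&` N).
Proof.
move=> hM hN; split; first by split; apply: csub0.
- by move=> a x y [? ?] [? ?]; split; apply: csubL.
- move=> u x ux ul; split.
    by apply: (csub_lim hM _ ul) => n; have [] := ux n.
  by apply: (csub_lim hN _ ul) => n; have [] := ux n.
Qed.

Definition perp F : set H := [set x | forall y, F y -> D x y = 0].

Lemma csub_perp F : csub (perp F).
Proof.
split => [y _|a x y hx hy z hz|u x ux ul z hz].
- by rewrite dot0l.
- by rewrite !dotE hx// hy// mulr0 addr0.
- by apply: (tends_dot ul) => n; apply: ux.
Qed.

Lemma perp_sub F F' : F `<=` F' -> perp F' `<=` perp F.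
Proof. by move=> h x hx y hy; apply/hx/h. Qed.

Definition cspan F := perp (perp F).

Lemma csub_cspan F : csub (cspan F). Proof. exact: csub_perp. Qed.
Lemma cspan_gen F : F `<=` cspan F.
Proof. by move=> x hx y hy; rewrite dotC hy. Qed.
Lemma perp_cspan F x y : perp F x -> cspan F y -> D x y = 0.
Proof. by move=> hx hy; rewrite dotC hy. Qed.

Lemma complete u : is_cauchy u -> exists x, tends u x.
Proof. exact: dot_complete. Qed.

Definition proj M x : H := xget 0 [set p | M p /\ forall y, M y -> D (x - p) y = 0].

Lemma proj_uniq M x p q : csub M -> M p -> M q ->
  (forall y, M y -> D (x - p) y = 0) -> (forall y, M y -> D (x - q) y = 0) ->
  p = q.
Proof.
move=> hM hp hq h1 h2; apply/eqP; rewrite -subr_eq0; apply/eqP/(@dot_eq0 _ D).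
have hpq : M (p - q) by apply: csubB.
rewrite -[X in D X _](_ : (x - q) - (x - p) = _); last first.
  by rewrite opprB addrC addrA subrK.
by rewrite dotBl h1// h2// subr0.
Qed.

Lemma parallelogram x y : D (x + y) (x + y) + D (x - y) (x - y) =
  2 * D x x + 2 * D y y.
Proof. by rewrite !dotE; ring. Qed.

(** A minimizing sequence for the distance from x to M is Cauchy by the
parallelogram law, and the minimality of its limit p gives the orthogonality of
x - p to M. *)
Lemma proj_exists M x : csub M ->
  exists p, M p /\ forall y, M y -> D (x - p) y = 0.
Proof.
move=> hM.
pose S := [set D (x - y) (x - y) | y in M].
have S0 : has_inf S.
  split; first by exists (D (x - 0) (x - 0)); exists 0 => //; apply: csub0.
  by exists 0 => _ [y _ <-]; apply: dot_ge0.
pose d := inf S.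
have dle y : M y -> d <= D (x - y) (x - y).
  by move=> hy; apply: ge_inf; [exact: S0.2|exists y].
have ex n : exists y, M y /\ D (x - y) (x - y) < d + n.+1%:R^-1.
  have [|_ [y hy <-] hlt] := @inf_adherent _ S n.+1%:R^-1 _ S0.
    by rewrite invr_gt0.
  by exists y.
pose y n := projT1 (cid (ex n)).
have yM n : M (y n) by rewrite /y; case: cid => ? [].
have yd n : D (x - y n) (x - y n) < d + n.+1%:R^-1 by rewrite /y; case: cid => ? [].
have yy m n : D (y m - y n) (y m - y n) <= 2 * m.+1%:R^-1 + 2 * n.+1%:R^-1.
  have := parallelogram (x - y m) (x - y n).
  have hmid : M (2^-1 *: (y m + y n)) by apply: csubZ => //; apply: csubD.
  have := dle _ hmid.
  have -> : x - y m - (x - y n) = y n - y m.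
    by rewrite opprB addrC addrA subrK.
  have -> : x - y m + (x - y n) = 2 *: (x - 2^-1 *: (y m + y n)).
    rewrite scalerBr scalerA divff ?pnatr_eq0// scale1r scaler_nat mulr2n.
    by rewrite opprD addrACA.
  rewrite -[y n - y m]opprB !dotNl !dotNr !opprK !dotZl !dotZr.
  have := yd m; have := yd n.
  set a := D _ _; set b := D _ _; set c := D _ _; set e := D _ _.
  by set r1 := m.+1%:R^-1; set r2 := n.+1%:R^-1 => *; lra.
have inv_small (e : R) : 0 < e -> exists n0, forall n, (n0 <= n)%N -> n.+1%:R^-1 < e.
  move=> e0; exists (Num.Def.truncn e^-1) => n hn.
  rewrite invf_plt ?posrE//; apply: lt_le_trans (truncnS_gt _) _.
  by rewrite ler_nat ltnS.
have /complete [p yp] : is_cauchy y.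
  move=> e e0; have e4 : 0 < e ^+ 2 / 4 by rewrite divr_gt0 ?exprn_gt0.
  have [n0 h0] := inv_small _ e4; exists n0 => m n hm hn.
  rewrite -(ltr_pXn2r (n := 2)) ?nnegrE ?nrm_ge0 ?(ltW e0)// nrm_sqr.
  move: (yy m n) (h0 _ hm) (h0 _ hn); set r1 := m.+1%:R^-1; set r2 := n.+1%:R^-1.
  by move=> *; lra.
have pM : M p by apply: (csub_lim hM _ yp).
have pd : D (x - p) (x - p) <= d.
  rewrite -nrm_sqr; apply/ler_addgt0Pr => e e0.
  have d0 : 0 <= d by apply: lb_le_inf; [exact: S0.1|move=> _ [? _ <-]; apply: dot_ge0].
  pose c := Num.sqrt (d + e).
  have c2 : c ^+ 2 = d + e by rewrite sqr_sqrtr// addr_ge0// ltW.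
  rewrite -c2 ler_pXn2r ?nnegrE ?nrm_ge0 ?sqrtr_ge0//.
  apply/ler_addgt0Pr => e' e'0.
  have [n1 h1] := inv_small _ e0; have [n2 h2] := yp _ e'0.
  pose n := maxn n1 n2.
  apply: le_trans (nrm_dist _ (y n) _) _; apply: lerD; last first.
    by rewrite ltW// h2// leq_maxr.
  apply: nrm_le_dot; first exact: sqrtr_ge0.
  rewrite c2 ltW// (lt_trans (yd n))// ltrD2l h1// leq_maxl//.
exists p; split=> // z hz.
(* Unless x - p is orthogonal to z, moving p along z brings it closer to x. *)
have [z0|z0] := eqVneq (D z z) 0; first by rewrite (dot_eq0 z0) dot0r.
have zp : 0 < D z z by rewrite lt_neqAle eq_sym z0 dot_ge0.
pose a := D (x - p) z / D z z.
have hpz : M (p + a *: z) by rewrite addrC; apply: csubL.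
have := le_trans pd (dle _ hpz).
rewrite opprD addrA.
have -> : D (x - p - a *: z) (x - p - a *: z) =
  D (x - p) (x - p) - D (x - p) z ^+ 2 / D z z.
  rewrite [LHS]dotBl !(dotBr (_ - _)) !dotZl !dotZr (dotC D z) /a.
  by field.
rewrite lerBrDl addrC -lerBrDl subrr => hle; apply/eqP; rewrite -sqrf_eq0.
have : 0 <= D (x - p) z ^+ 2 / D z z by rewrite divr_ge0 ?sqr_ge0 ?ltW.
move=> hge; have /eqP : D (x - p) z ^+ 2 / D z z = 0 by apply/le_anti/andP.
by rewrite mulf_eq0 invr_eq0 (negPf z0) orbF.
Qed.

Lemma projP M x : csub M ->
  M (proj M x) /\ forall y, M y -> D (x - proj M x) y = 0.
Proof.
move=> hM; rewrite /proj; case: xgetP => [p -> //|h].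
by have [p /h] := proj_exists x hM.
Qed.

Lemma projM M x : csub M -> M (proj M x).
Proof. by move=> hM; have [] := projP x hM. Qed.
Lemma proj_perp M x y : csub M -> M y -> D (x - proj M x) y = 0.
Proof. by move=> hM; have [_ h] := projP x hM; apply: h. Qed.
Lemma proj_eq M x p : csub M -> M p -> (forall y, M y -> D (x - p) y = 0) ->
  proj M x = p.
Proof. by move=> hM hp h; have [? ?] := projP x hM; apply: proj_uniq h. Qed.
Lemma proj_id M x : csub M -> M x -> proj M x = x.
Proof. by move=> hM hx; apply: proj_eq => // y _; rewrite subrr dot0l. Qed.
Lemma proj_dot M x y : csub M -> M y -> D (proj M x) y = D x y.
Proof. by move=> hM hy; apply/esym/eqP; rewrite -subr_eq0 -dotBl proj_perp. Qed.
Lemma proj_sym M x y : csub M -> D (proj M x) y = D x (proj M y).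
Proof.
move=> hM; rewrite -(proj_dot x hM (projM y hM)) dotC.
by rewrite -[LHS](proj_dot y hM (projM x hM)) dotC.
Qed.
Lemma projL M a x y : csub M -> proj M (a *: x + y) = a *: proj M x + proj M y.
Proof.
move=> hM; apply: proj_eq => //; first by apply: csubL => //; apply: projM.
by move=> z hz; rewrite opprD addrACA -scalerBr dotDl dotZl !proj_perp// mulr0 addr0.
Qed.
Lemma projD M x y : csub M -> proj M (x + y) = proj M x + proj M y.
Proof. by move=> hM; rewrite -[x in LHS]scale1r projL// scale1r. Qed.
Lemma proj0 M : csub M -> proj M 0 = 0.
Proof. by move=> hM; apply: proj_id => //; apply: csub0. Qed.
Lemma projZ M a x : csub M -> proj M (a *: x) = a *: proj M x.
Proof. by move=> hM; rewrite -[a *: x]addr0 projL// proj0// addr0. Qed.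
Lemma projN M x : csub M -> proj M (- x) = - proj M x.
Proof. by move=> hM; rewrite -scaleN1r projZ// scaleN1r. Qed.
Lemma projB M x y : csub M -> proj M (x - y) = proj M x - proj M y.
Proof. by move=> hM; rewrite projD// projN. Qed.
Lemma proj_perp0 M x : csub M -> (forall y, M y -> D x y = 0) -> proj M x = 0.
Proof. by move=> hM h; apply: proj_eq => // [|y hy]; [exact: csub0|rewrite subr0 h]. Qed.

Lemma proj_pyth M x : csub M ->
  D x x = D (proj M x) (proj M x) + D (x - proj M x) (x - proj M x).
Proof.
move=> hM; have h := proj_perp x hM (projM x hM).
move: h; set p := proj M x => h.
have -> : D x x = D p p + 2 * D (x - p) p + D (x - p) (x - p).
  by rewrite !dotE (dotC D p x); ring.
by rewrite h mulr0 addr0.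
Qed.
Lemma proj_le M x : csub M -> nrm (proj M x) <= nrm x.
Proof.
move=> hM; apply: nrm_le_dot; first exact: nrm_ge0.
by rewrite nrm_sqr (proj_pyth x hM) lerDl dot_ge0.
Qed.
Lemma proj_dist M x y : csub M -> nrm (proj M x - proj M y) <= nrm (x - y).
Proof. by move=> hM; rewrite -projB// proj_le. Qed.
Lemma proj_best M x y : csub M -> M y -> nrm (x - proj M x) <= nrm (x - y).
Proof.
move=> hM hy; apply: nrm_le_dot; first exact: nrm_ge0.
rewrite nrm_sqr (proj_pyth (x - y) hM) projB// (proj_id hM hy).
by rewrite opprB addrA subrK lerDr dot_ge0.
Qed.
(** By Pythagoras a projection shortens every vector outside of M. *)
Lemma proj_fix M x : csub M -> nrm x <= nrm (proj M x) -> M x.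
Proof.
move=> hM h; suff -> : x = proj M x by apply: projM.
apply/eqP; rewrite -subr_eq0; apply/eqP/(@dot_eq0 _ D)/le_anti.
rewrite dot_ge0 andbT.
have := proj_pyth x hM; rewrite -!nrm_sqr.
by have := nrm_ge0 x; have := nrm_ge0 (proj M x) => *; nra.
Qed.

End RealHilbert.

(** * Alternating projections, perturbed projections and words *)

Section Alternating.
Variables (R : realType) (H : lmodType R) (D : hilbert H).
Implicit Types (x y z : H) (M N F : set H).
Local Notation nrm := (nrm D).
Local Notation proj := (proj D).
Local Notation csub := (csub D).

(** The positive contraction alternating between M and N; it starts and ends in
M, which makes it self-adjoint. *)
Definition alt M N x := proj M (proj N (proj M x)).

Lemma alt_le M N x : csub M -> csub N -> nrm (alt M N x) <= nrm x.
Proof.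
by move=> hM hN; rewrite (le_trans (proj_le _ hM))// (le_trans (proj_le _ hN))// proj_le.
Qed.

Lemma altB M N x y : csub M -> csub N -> alt M N x - alt M N y = alt M N (x - y).
Proof. by move=> hM hN; rewrite /alt !projB. Qed.

Lemma alt_sym M N x y : csub M -> csub N -> D (alt M N x) y = D x (alt M N y).
Proof. by move=> hM hN; rewrite /alt !proj_sym. Qed.

Lemma alt_dot M N x : csub M -> csub N ->
  D (alt M N x) x = nrm (proj N (proj M x)) ^+ 2.
Proof. by move=> hM hN; rewrite /alt proj_sym// nrm_sqr [RHS](proj_dot _ hN (projM _ hN)) dotC. Qed.

(** Von Neumann's theorem.  With T the self-adjoint operator [alt M N], the
numbers a n = <T^n x, x> satisfy <T^m x, T^n x> = a (m + n); they decrease and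
are nonnegative, hence
|T^m x - T^n x|^2 = a (2m) + a (2n) - 2 a (m + n) tends to 0.  The limit is fixed
by T, and a vector that keeps its norm under all factors of T lies in M and N. *)
Theorem alternating_projections M N x : csub M -> csub N ->
  tends D (fun n => iter n (alt M N) x) (proj (M `&` N) x).
Proof.
move=> hM hN; set T := alt M N; set u := fun n => iter n T x.
pose a n := D (u n) x.
have aD m n : D (u m) (u n) = a (m + n)%N.
  elim: n m => [|n IH] m; first by rewrite addn0.
  by rewrite addnS -addSn -IH /u !iterS /T alt_sym.
have adecr1 y : nrm (T y) ^+ 2 <= D (T y) y.
  rewrite alt_dot// ler_pXn2r ?nnegrE ?nrm_ge0//.
  by rewrite /T /alt proj_le.
have adecr2 y : D (T y) y <= nrm y ^+ 2.
  rewrite alt_dot// ler_pXn2r ?nnegrE ?nrm_ge0//.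
  by rewrite (le_trans (proj_le _ hN))// proj_le.
(* Even indices are squared norms of iterates, which decides the parity split. *)
have aS n : a n.+1 <= a n.
  rewrite -[in a n](odd_double_half n) -[in a n.+1](odd_double_half n).
  rewrite -addnn; case: (odd n) => /=.
    rewrite add1n -addnS -addSn -aD addnC -aD -nrm_sqr.
    exact: adecr1.
  by rewrite add0n -addSn -!aD -nrm_sqr; exact: adecr2.
have amono m n : (m <= n)%N -> a n <= a m.
  by move=> /subnK <-; elim: (n - m)%N => [|k IH]; rewrite ?add0n// addSn (le_trans (aS _)).
have a0 n : 0 <= a n.
  rewrite -[n](odd_double_half n) -addnn; case: (odd n) => /=.
    by rewrite add1n -addSn -aD alt_dot// exprn_ge0// nrm_ge0.
  by rewrite add0n -aD dot_ge0.
have hS : has_inf (range a).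
  by split; [exists (a 0%N), 0%N|exists 0 => _ [n _ <-]].
have [y uy] : exists y, tends D u y.
  apply: complete => e e0.
  have e2 : 0 < e ^+ 2 / 4 by rewrite divr_gt0 ?exprn_gt0.
  have [_ [n0 _ <-] hlt] := inf_adherent e2 hS.
  exists n0 => m n hm hn.
  rewrite -(ltr_pXn2r (n := 2)) ?nnegrE ?nrm_ge0 ?(ltW e0)// nrm_sqr.
  rewrite !dotE !aD (addnC n m).
  have l1 k : (n0 <= k)%N -> inf (range a) <= a k < inf (range a) + e ^+ 2 / 4.
    move=> hk; rewrite (le_lt_trans (amono _ _ hk) hlt) andbT.
    by apply: ge_inf; [exact: hS.2|exists k].
  have /andP[_ h1] := l1 (m + m)%N (leq_trans hm (leq_addr _ _)).
  have /andP[_ h2] := l1 (n + n)%N (leq_trans hn (leq_addr _ _)).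
  have /andP[h3 _] := l1 (m + n)%N (leq_trans hm (leq_addr _ _)).
  have e20 : 0 < e ^+ 2 by rewrite exprn_gt0.
  move: h1 h2 h3 e20; set e2' := e ^+ 2; set i := inf _.
  by move=> *; lra.
suff -> : proj (M `&` N) x = y by [].
have Ty : T y = y.
  apply: (tends_uniq (D := D) (u := fun n => u n.+1)) => e /uy[n0 h].
    exists n0 => n /h; apply: le_lt_trans; rewrite /u iterS.
    by rewrite altB// alt_le.
  by exists n0 => n hn; apply: h; apply: leqW.
have yM : M y.
  apply: (proj_fix hM); rewrite -{1}Ty /T /alt.
  by rewrite (le_trans (proj_le _ hM))// (le_trans (proj_le _ hN)).
have yN : N y.
  apply: (proj_fix hN); rewrite -{1}Ty /T /alt (proj_id hM yM).
  by rewrite (le_trans (proj_le _ hM)).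
apply: proj_eq => [||z [zM zN]]; [exact: csubI|by []|].
rewrite dotBl; apply/eqP; rewrite subr_eq0 eq_sym; apply/eqP.
apply: (tends_dot uy) => n; elim: n => [//|n IH].
by rewrite /u iterS /T alt_sym// /alt (proj_id hM zM) (proj_id hN zN) (proj_id hM zM).
Qed.

(** A one-sided estimate: if x - proj M x is orthogonal to N as well, then
projecting onto N amounts to projecting proj M x. *)
Lemma proj_near M N x y : csub M -> csub N ->
  (forall z, N z -> D (x - proj M x) z = 0) -> N y ->
  nrm (proj M x - proj N x) <= nrm (proj M x - y).
Proof.
move=> hM hN h Ny.
have -> : proj N x = proj N (proj M x).
  apply: proj_eq => [//||z Nz]; first exact: projM.
  rewrite -[x](subrK (proj M x)) -addrA dotDl (h z Nz) add0r.
  by rewrite (subrK (proj M x)) proj_perp.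
exact: proj_best.
Qed.

(** Subspaces with a small gap have close projections: the component of x in M
moves by at most g, and the projection v to N of the component orthogonal to M
is small, since v is close to M. *)
Lemma proj_gap M N x g : csub M -> csub N -> 0 <= g ->
  (forall y, M y -> exists2 y', N y' & nrm (y - y') <= g * nrm y) ->
  (forall y, N y -> exists2 y', M y' & nrm (y - y') <= g * nrm y) ->
  nrm (proj M x - proj N x) <= 2 * g * nrm x.
Proof.
move=> hM hN g0 hMN hNM; set p := proj M x.
have [p' Np' hp'] := hMN _ (projM x hM).
set v := proj N (x - p).
have [v' Mv' hv'] := hNM _ (projM (x - p) hN).
have hx : nrm (x - p) <= nrm x.
  apply: nrm_le_dot; first exact: nrm_ge0.
  by rewrite nrm_sqr (proj_pyth x hM) lerDr dot_ge0.
have vg : nrm v <= g * nrm x.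
  have : nrm v ^+ 2 <= nrm x * (g * nrm v).
    rewrite nrm_sqr {1}/v proj_dot//; last exact: projM.
    have -> : D (x - p) v = D (x - p) (v - v').
      by rewrite dotBr [X in _ = _ - X]proj_perp// subr0.
    apply: le_trans (ler_norm _) _; apply: le_trans (cauchy_schwarz _ _ _) _.
    by apply: ler_pM => //; exact: nrm_ge0.
  have := nrm_ge0 D v; have := nrm_ge0 D x => x0 v0.
  have [->|vn0] := eqVneq (nrm v) 0; first by rewrite mulr_ge0.
  have vp : 0 < nrm v by rewrite lt_neqAle eq_sym vn0.
  by rewrite expr2 mulrA (mulrC _ g) ler_pM2r.
have -> : p - proj N x = (p - proj N p) - v.
  by rewrite /v projB// opprB addrA subrK.
apply: le_trans (nrmD _ _ _) _; rewrite nrmN -mulrA mulr2n mulrDl mul1r lerD//.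
apply: le_trans (proj_best _ hN Np') _; apply: le_trans hp' _.
by rewrite ler_wpM2l// proj_le.
Qed.

Definition act (A : Type) (P : A -> H -> H) (s : seq A) x :=
  foldl (fun x a => P a x) x s.

Lemma act_cat A (P : A -> H -> H) s s' x : act P (s ++ s') x = act P s' (act P s x).
Proof. exact: foldl_cat. Qed.

Lemma act_dist A (P : A -> H -> H) s x y :
  (forall a x y, nrm (P a x - P a y) <= nrm (x - y)) ->
  nrm (act P s x - act P s y) <= nrm (x - y).
Proof. by move=> h; elim: s x y => //= a s IH x y; rewrite (le_trans (IH _ _)). Qed.

(** Errors of the single letters add up along a word, provided that the ideal
operators Q preserve the set B on which they are compared with P. *)
Lemma act_near A (P Q : A -> H -> H) (B : set H) (g : A -> R) s x :
  (forall a x y, nrm (P a x - P a y) <= nrm (x - y)) ->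
  (forall a x, B x -> B (Q a x)) -> (forall a x, nrm (Q a x) <= nrm x) ->
  (forall a, 0 <= g a) ->
  (forall a x, B x -> nrm (P a x - Q a x) <= g a * nrm x) -> B x ->
  nrm (act P s x - act Q s x) <= (\sum_(a <- s) g a) * nrm x.
Proof.
move=> hP hB hQ g0 hg; elim: s x => [|a s IH] x Bx /=.
  by rewrite subrr nrm0 big_nil mul0r.
rewrite big_cons mulrDl; apply: le_trans (nrm_dist _ _ (act P s (Q a x)) _) _.
apply: lerD; first exact: le_trans (act_dist _ _ _ hP) (hg _ _ Bx).
apply: le_trans (IH _ (hB _ _ Bx)) _; rewrite ler_wpM2l//.
exact: sumr_ge0.
Qed.

Lemma iter_near (S T : H -> H) (B : set H) d n x c : 0 <= d ->
  (forall x y, nrm (S x - S y) <= nrm (x - y)) ->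
  (forall x, B x -> B (T x)) -> (forall x, nrm (T x) <= nrm x) ->
  (forall x, B x -> nrm (S x - T x) <= d * nrm x) -> B x -> nrm x <= c ->
  nrm (iter n S x - iter n T x) <= n%:R * d * c.
Proof.
move=> d0 hS hB hT h Bx xc.
have c0 : 0 <= c by apply: le_trans xc; apply: nrm_ge0.
have hBT m : B (iter m T x) /\ nrm (iter m T x) <= c.
  elim: m => [//|m [IH1 IH2]]; rewrite iterS; split; first exact: hB.
  exact: le_trans (hT _) IH2.
elim: n => [|n IH]; first by rewrite subrr nrm0 !mul0r.
rewrite !iterS; apply: le_trans (nrm_dist _ _ (S (iter n T x)) _) _.
rewrite mulrSr !mulrDl mul1r; apply: lerD; first exact: le_trans (hS _ _) IH.
have [h1 h2] := hBT n.
by apply: le_trans (h _ h1) _; rewrite ler_wpM2l.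
Qed.

End Alternating.

Section Graph.
Variables (R : realType) (H : lmodType R) (D : hilbert H).
Variables (I : finType) (w : I -> H).
Hypothesis w_on : forall i j, D (w i) (w j) = (i == j)%:R.
Implicit Types (x y : H) (r : I -> H) (B : set H).

(** The part of B cut out by prescribing the coordinates along the orthonormal
vectors w i as linear functions of the other coordinates. *)
Definition graph B r : set H := B `&` perp D (range (fun i => w i - r i)).

Lemma csub_graph B r : csub D B -> csub D (graph B r).
Proof. by move=> hB; apply: csubI => //; apply: csub_perp. Qed.

Lemma graphP B r x : graph B r x <-> B x /\ forall i, D x (w i) = D x (r i).
Proof.
split=> [[Bx h]|[Bx h]]; split=> //.
  by move=> i; apply/eqP; rewrite -subr_eq0 -dotBr; apply/eqP/h; exists i.
by move=> _ [i _ <-]; rewrite dotBr h subrr.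
Qed.

Lemma nrm_on i : nrm D (w i) = 1.
Proof. by rewrite /nrm w_on eqxx sqrtr1. Qed.

(** Correcting the w i coordinates of a point of one graph yields a point of the
other. *)
Lemma graph_near B r r' y : csub D B -> (forall i, B (w i)) ->
  (forall i j, D (w i) (r' j) = 0) -> graph B r y ->
  exists2 y', graph B r' y' &
    nrm D (y - y') <= (\sum_i nrm D (r i - r' i)) * nrm D y.
Proof.
move=> hB Bw wr /graphP[By hy].
pose c := \sum_i D y (r' i - r i) *: w i.
exists (y + c).
  apply/graphP; split; first apply: (csubD hB By).
    by apply: (csub_sum _ hB) => i _; apply: (csubZ _ hB).
  move=> i; rewrite !dotDl hy /c !dot_suml.
  rewrite [X in _ = _ + X]big1 => [|j _]; last by rewrite dotZl wr mulr0.
  rewrite (bigD1 i)//= dotZl w_on eqxx mulr1 big1 => [|j ji].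
    by rewrite !addr0 dotBr addrC subrK.
  by rewrite dotZl w_on (negPf ji) mulr0.
rewrite opprD addrA subrr add0r nrmN.
apply: le_trans (nrm_sum _ _ _ _) _; rewrite mulr_suml; apply: ler_sum => i _.
by rewrite nrmZ nrm_on mulr1 mulrC (nrmB _ (r i)) cauchy_schwarz.
Qed.

Lemma graph_gap B r r' x : csub D B -> (forall i, B (w i)) ->
  (forall i j, D (w i) (r j) = 0) -> (forall i j, D (w i) (r' j) = 0) ->
  nrm D (proj D (graph B r) x - proj D (graph B r') x) <=
    2 * (\sum_i nrm D (r i - r' i)) * nrm D x.
Proof.
move=> hB Bw wr wr'; apply: proj_gap; try exact: csub_graph.
- by apply: sumr_ge0 => i _; apply: nrm_ge0.
- by move=> y /(graph_near hB Bw wr').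
- move=> y /(graph_near hB Bw wr)[y' h1 h2]; exists y' => //.
  by under eq_bigr => i _ do rewrite nrmB.
Qed.

End Graph.

(** * A quarter turn with three subspaces *)

Section Choices.
Variable R : realType.

(** The last value is M, and each b i is then chosen after all b j with j > i. *)
Lemma choose_increasing (rho : nat -> R -> R) k (M : R) :
  (forall j x, 0 < x -> 0 < rho j x) -> 0 < M ->
  exists b : nat -> R, forall j, (j < k)%N ->
    0 < b j <= M /\ forall i, (i < j)%N -> b i <= rho j (b j).
Proof.
move=> rho0; elim: k M => [|k IH] M M0; first by exists (fun=> 1).
have [|b hb] := IH (Num.min M (rho k M)); first by rewrite lt_min M0 rho0.
exists (fun j => if j == k then M else b j) => j; rewrite ltnS leq_eqVlt.
case/orP => [/eqP ->|jk].
  rewrite eqxx M0 lexx; split=> // i ik; rewrite ltn_eqF//.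
  by have [/andP[_]] := hb _ ik; rewrite le_min => /andP[].
have [/andP[b0]] := hb _ jk; rewrite ltn_eqF// le_min b0 => /andP[-> _] h.
by split=> // i ij; rewrite ltn_eqF ?h// (ltn_trans ij).
Qed.

(** Each t i is chosen in T i after its predecessors; the bound rho j t may
depend on the whole initial segment of t up to j. *)
Lemma choose_decreasing (T : nat -> set R) (rho : nat -> (nat -> R) -> R) k (M : R) :
  (forall i r, 0 < r -> exists2 x, T i x & 0 < x < r) ->
  (forall j t, (forall i, (i <= j)%N -> 0 < t i) -> 0 < rho j t) ->
  (forall j t t', (forall i, (i <= j)%N -> t i = t' i) -> rho j t = rho j t') ->
  0 < M ->
  exists t : nat -> R, forall i, (i < k)%N ->
    [/\ T i (t i), 0 < t i < M & forall j, (j < i)%N -> t i <= rho j t].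
Proof.
move=> T0 rho0 rhoE M0; elim: k => [|k [t ht]]; first by exists (fun=> 1).
pose m := \big[Num.min/M]_(j < k) rho j t.
have m0 : 0 < m.
  rewrite /m; elim/big_ind: _ => // [x y x0 y0|i _]; first by rewrite lt_min x0.
  apply: rho0 => j ji.
  by have [_ /andP[]] := ht j (leq_ltn_trans ji (ltn_ord i)).
have [x Tx /andP[x0 xm]] := T0 k _ m0.
have mM : m <= M by rewrite /m bigmin_le_id.
have mr j : (j < k)%N -> m <= rho j t.
  by move=> jk; rewrite (bigmin_le M (Ordinal jk) (fun j => rho j t)).
pose t' j := if j == k then x else t j.
have tE j : (j < k)%N -> rho j t' = rho j t.
  by move=> jk; apply: rhoE => i ij; rewrite /t' ltn_eqF// (leq_ltn_trans ij).
exists t' => i; rewrite ltnS leq_eqVlt => /orP[/eqP ->|ik].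
  rewrite {1 2 3}/t' eqxx x0 (lt_le_trans xm mM); split=> // j jk.
  by rewrite tE// /t' eqxx (le_trans (ltW xm))// mr.
have [h1 h2 h3] := ht _ ik; rewrite {1 2 3}/t' ltn_eqF//; split=> // j ji.
by rewrite tE ?(ltn_trans ji)// /t' ltn_eqF// h3.
Qed.

End Choices.

(** The letters of the words that perform a quarter turn. *)
Inductive role := rX | rS | rY.
Definition isX a := if a is rX then true else false.

Section Machine.
Variables (R : realType) (H : lmodType R) (D : hilbert H).
Local Notation nrm := (nrm D).
Local Notation proj := (proj D).
Local Notation csub := (csub D).
Local Notation alt := (alt D).
Variables (k : nat) (u v : H) (z w : 'I_k -> H).
Hypotheses (uu : D u u = 1) (vv : D v v = 1) (uv : D u v = 0).
Hypotheses (zz : forall i j, D (z i) (z j) = (i == j)%:R).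
Hypotheses (ww : forall i j, D (w i) (w j) = (i == j)%:R).
Hypotheses (zw : forall i j, D (z i) (w j) = 0).
Hypotheses (zu : forall i, D (z i) u = 0) (zv : forall i, D (z i) v = 0).
Hypotheses (wu : forall i, D (w i) u = 0) (wv : forall i, D (w i) v = 0).
Variables (al be : nat -> R).
Hypothesis circ : forall j, al j ^+ 2 + be j ^+ 2 = 1.

(** The points h_j of the path from u to v. *)
Definition turn j := al j *: u + be j *: v.
(** The direction orthogonal to h_(j+1) in the plane of u and v. *)
Definition normal j := al j.+1 *: v - be j.+1 *: u.
Definition block := cspan D ([set u; v] `|` range z `|` range w).
Definition spaceS := block `&` perp D (range w).
Definition spaceX := spaceS `&` perp D (range z).
(** The space onto which the powers of SYS converge when t i is nonzero exactly for
i <= m; see [spaceSY_limit]. *)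
Definition spaceL m (b : nat -> R) :=
  graph D (fun i : {i : 'I_k | (i <= m)%N} => z (val i)) spaceS
    (fun i => b (val i) *: normal (val i)).
Definition qvec (b : nat -> R) (i : 'I_k) := z i - b i *: normal i.
Definition spaceY b (t : nat -> R) := graph D w block (fun i => t i *: qvec b i).
Definition ideal b t a :=
  match a with rX => spaceX | rS => spaceS | rY => spaceY b t end.

Let vu : D v u = 0. Proof. by rewrite dotC. Qed.
Let wz i j : D (w i) (z j) = 0. Proof. by rewrite dotC. Qed.
Let uw i : D u (w i) = 0. Proof. by rewrite dotC. Qed.
Let vw i : D v (w i) = 0. Proof. by rewrite dotC. Qed.
Let uz i : D u (z i) = 0. Proof. by rewrite dotC. Qed.
Let vz i : D v (z i) = 0. Proof. by rewrite dotC. Qed.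
Let E := (uu, vv, uv, vu, zw, wz, zu, zv, uz, vz, wu, wv, uw, vw).

Lemma csub_block : csub block. Proof. exact: csub_cspan. Qed.
Lemma csub_spaceS : csub spaceS.
Proof. by apply: csubI; [exact: csub_block|exact: csub_perp]. Qed.
Lemma csub_spaceX : csub spaceX.
Proof. by apply: csubI; [exact: csub_spaceS|exact: csub_perp]. Qed.
Lemma csub_spaceL m b : csub (spaceL m b).
Proof. exact/csub_graph/csub_spaceS. Qed.
Lemma csub_spaceY b t : csub (spaceY b t).
Proof. exact/csub_graph/csub_block. Qed.
Lemma csub_ideal b t a : csub (ideal b t a).
Proof. by case: a; [exact: csub_spaceX|exact: csub_spaceS|exact: csub_spaceY]. Qed.

Lemma block_u : block u. Proof. by apply: cspan_gen; do 2 left; left. Qed.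
Lemma block_v : block v. Proof. by apply: cspan_gen; do 2 left; right. Qed.
Lemma block_z i : block (z i). Proof. by apply: cspan_gen; left; right; exists i. Qed.
Lemma block_w i : block (w i). Proof. by apply: cspan_gen; right; exists i. Qed.

Lemma block_ext x : block x -> D x u = 0 -> D x v = 0 ->
  (forall i, D x (z i) = 0) -> (forall i, D x (w i) = 0) -> x = 0.
Proof.
move=> Bx xu xv xz xw; apply: (@dot_eq0 _ _ D); apply: (perp_cspan _ Bx).
by move=> y [[[->|->]|[i _ <-]]|[i _ <-]].
Qed.

Lemma spaceSP x : spaceS x <-> block x /\ forall i, D x (w i) = 0.
Proof.
split=> [[h1 h2]|[h1 h2]]; split=> //; first by move=> i; apply: h2; exists i.
by move=> _ [i _ <-].
Qed.
Lemma spaceXP x : spaceX x <-> spaceS x /\ forall i, D x (z i) = 0.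
Proof.
split=> [[h1 h2]|[h1 h2]]; split=> //; first by move=> i; apply: h2; exists i.
by move=> _ [i _ <-].
Qed.

Lemma spaceX_u : spaceX u.
Proof.
apply/spaceXP; split=> [|i]; rewrite ?E//.
by apply/spaceSP; split=> [|i]; rewrite ?E//; exact: block_u.
Qed.
Lemma spaceX_v : spaceX v.
Proof.
apply/spaceXP; split=> [|i]; rewrite ?E//.
by apply/spaceSP; split=> [|i]; rewrite ?E//; exact: block_v.
Qed.
Lemma spaceS_z i : spaceS (z i).
Proof. by apply/spaceSP; split=> [|j]; rewrite ?E//; exact: block_z. Qed.

Lemma spaceX_coord x : spaceX x -> x = D x u *: u + D x v *: v.
Proof.
move=> /spaceXP[/spaceSP[Bx xw] xz]; apply/eqP; rewrite -subr_eq0; apply/eqP.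
apply: block_ext; first apply: (csubB csub_block Bx).
- by apply: (csubL csub_block); [exact: block_u|apply: csubZ csub_block block_v].
- by rewrite !dotE !E; ring.
- by rewrite !dotE !E; ring.
- by move=> i; rewrite !dotE !E xz; ring.
- by move=> i; rewrite !dotE !E xw; ring.
Qed.

Lemma spaceX_turn j : spaceX (turn j).
Proof. by apply: (csubL csub_spaceX); [exact: spaceX_u|exact: csubZ csub_spaceX spaceX_v]. Qed.

Lemma dot_turn i j : D (turn i) (turn j) = al i * al j + be i * be j.
Proof. by rewrite /turn !dotE !E; ring. Qed.
Lemma nrm_turn j : nrm (turn j) = 1.
Proof. by apply: nrm1; rewrite dot_turn -!expr2 circ. Qed.
Lemma nrm_normal j : nrm (normal j) = 1.
Proof. by apply: nrm1; rewrite /normal !dotE !E -[RHS](circ j.+1); ring. Qed.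
Lemma dot_z_normal i j : D (z i) (normal j) = 0.
Proof. by rewrite /normal !dotE !E; ring. Qed.
Lemma dot_w_qvec b i j : D (w i) (qvec b j) = 0.
Proof. by rewrite /qvec /normal !dotE !E; ring. Qed.
Lemma nrm_qvec (b : nat -> R) (i : 'I_k) : `|b i| <= 1 -> nrm (qvec b i) <= 2.
Proof.
move=> b1; apply: le_trans (nrmD _ _ _) _; rewrite nrmN nrmZ nrm_normal mulr1.
by rewrite (nrm1 (x := z i)) ?zz ?eqxx//; lra.
Qed.

Lemma zsub_on m (i j : {i : 'I_k | (i <= m)%N}) :
  D (z (val i)) (z (val j)) = (i == j)%:R.
Proof. by rewrite zz (inj_eq val_inj). Qed.

Lemma spaceLP m b x : spaceL m b x <->
  spaceS x /\ forall i : 'I_k, (i <= m)%N -> D x (z i) = b i * D x (normal i).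
Proof.
split=> [/graphP[Sx h]|[Sx h]].
  by split=> // i im; have := h (exist _ i im); rewrite dotZr.
by apply/graphP; split=> // -[i im] /=; rewrite dotZr h.
Qed.

Lemma spaceYP b t x : spaceY b t x <->
  block x /\ forall i, D x (w i) = t i * D x (qvec b i).
Proof. by split=> [/graphP[Bx h]|[Bx h]]; [|apply/graphP]; split=> // i; rewrite ?h dotZr. Qed.


(** When b vanishes below j, the vectors of X in the j-th constrained space are
those orthogonal to [normal j], that is, the multiples of h_(j+1). *)
Lemma proj_line (j : 'I_k) (b : nat -> R) : b j != 0 ->
  (forall i, (i < j)%N -> b i = 0) ->
  proj (spaceX `&` spaceL j b) (turn j) = D (turn j) (turn j.+1) *: turn j.+1.
Proof.
move=> b0 bi; apply: proj_eq.
- by apply: csubI; [exact: csub_spaceX|exact: csub_spaceL].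
- have hX : spaceX (D (turn j) (turn j.+1) *: turn j.+1).
    exact: csubZ csub_spaceX (spaceX_turn _).
  split=> //; apply/spaceLP; move/spaceXP: hX => [hS hz]; split=> // i.
  rewrite hz leq_eqVlt => /orP[/eqP/val_inj ->|/bi ->]; last by rewrite mul0r.
  by rewrite /turn /normal !dotE !E; ring.
- move=> y [/spaceXP[_ yz] /spaceLP[_ yL]].
  have := yL j (leqnn _); rewrite yz => /esym/eqP.
  rewrite mulf_eq0 (negPf b0)/= => /eqP; rewrite dotC /normal /turn !dotE !E.
  have := circ j.+1; set p := D u y; set q := D v y.
  set a := al j; set c := be j; set a' := al j.+1; set c' := be j.+1 => h0 h1.
  transitivity ((c * a' - a * c') * (a' * q - c' * p) +
    (1 - (a' ^+ 2 + c' ^+ 2)) * (a * p + c * q)); first by ring.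
  by rewrite h0 h1; ring.
Qed.

(** The exponent p is chosen for the sequence b0 that vanishes below j; by
continuity it still works when these entries are small instead of zero. *)
Lemma line_power (j : 'I_k) (x d : R) : 0 < x -> 0 < d ->
  exists p, exists2 rho, 0 < rho & forall b : nat -> R, b j = x ->
    (forall i, (i < j)%N -> 0 <= b i <= rho) ->
    nrm (iter p (alt spaceX (spaceL j b)) (turn j) -
         D (turn j) (turn j.+1) *: turn j.+1) <= d.
Proof.
move=> x0 d0; pose b0 i := if (i : nat) == j then x else 0.
have d2 : 0 < d / 2 by rewrite divr_gt0.
have [p hp] := alternating_projections (turn j) csub_spaceX (csub_spaceL j b0) d2.
rewrite proj_line /b0 ?eqxx ?gt_eqF// in hp; last first.
  by move=> i ij; rewrite ltn_eqF.
have := hp p (leqnn p) => {}hp.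
(* Each of the p steps is perturbed by at most 2 k rho; c makes the total d / 2. *)
pose c : R := 4 * (p.+1%:R * k.+1%:R).
have c0 : 0 < c by rewrite !mulr_gt0.
exists p, (d / c); first by rewrite divr_gt0.
move=> b bj bi; apply: le_trans (nrm_dist _ _ (iter p (alt spaceX (spaceL j b0)) (turn j)) _) _.
rewrite [d in _ <= d]splitr; apply: lerD (ltW hp).
pose g := 2 * (k%:R * (d / c)).
have dc0 : 0 <= d / c by apply/ltW/divr_gt0.
have g0 : 0 <= g by do 2![apply: mulr_ge0 => //].
apply: (@le_trans _ _ (p%:R * g * 1)).
  apply: (iter_near (D := D) (B := setT)) => //.
  - by move=> y y'; rewrite altB ?alt_le//; (exact: csub_spaceX || exact: csub_spaceL).
  - by move=> y; rewrite alt_le//; (exact: csub_spaceX || exact: csub_spaceL).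
  - move=> y _; rewrite /alt; apply: le_trans (proj_dist _ _ csub_spaceX) _.
    apply: le_trans (graph_gap (zsub_on (m:=j)) _ csub_spaceS _ _ _) _.
    + by move=> i; exact: spaceS_z.
    + by move=> i i'; rewrite dotZr dot_z_normal mulr0.
    + by move=> i i'; rewrite dotZr dot_z_normal mulr0.
    apply: ler_pM; rewrite ?nrm_ge0 ?mulr_ge0 ?sumr_ge0 ?proj_le ?csub_spaceX//.
      by move=> i _; apply: nrm_ge0.
    rewrite ler_wpM2l//; apply: (@le_trans _ _ (\sum_(i : {i : 'I_k | (i <= j)%N}) d / c)).
      apply: ler_sum => -[i ij] _ /=; rewrite -scalerBl nrmZ nrm_normal mulr1 /b0.
      case: eqP => [->|/eqP ne]; first by rewrite bj subrr normr0.
      have /andP[h1 h2] : 0 <= b i <= d / c by apply: bi; rewrite ltn_neqAle ne.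
      by rewrite subr0 ger0_norm.
    rewrite sumr_const -[X in X <= _]mulr_natl ler_wpM2r ?ler_nat//.
    by rewrite -[X in (_ <= X)%N]card_ord card_sig; apply: max_card.
    exact: csub_spaceX.
  by rewrite nrm_turn.
rewrite mulr1 /g.
have -> : p%:R * (2 * (k%:R * (d / c))) = d / 2 * (p%:R * k%:R / (p.+1%:R * k.+1%:R)).
  have : p.+1%:R * k.+1%:R != 0 :> R by rewrite mulf_neq0 ?pnatr_eq0.
  by rewrite /c; move: (p.+1%:R * _) => m m0; field.
apply: ler_piMr; first exact: ltW.
rewrite ler_pdivrMr ?mulr_gt0// mul1r.
by apply: ler_pM; rewrite ?ler_nat.
Qed.

(** On S the w coordinates vanish, so a constraint of Y with t i nonzero becomes
a constraint of L, and one with t i = 0 becomes void. *)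
Lemma spaceSY_limit m (b t : nat -> R) :
  (forall i, (i <= m)%N -> t i != 0) -> (forall i, (m < i)%N -> t i = 0) ->
  spaceS `&` spaceY b t = spaceL m b.
Proof.
move=> t1 t2; apply/seteqP; split=> x.
  move=> [Sx /spaceYP[_ hY]]; apply/spaceLP; split=> // i im.
  have /spaceSP[_ xw] := Sx; have /esym/eqP := hY i.
  rewrite xw mulf_eq0 (negPf (t1 _ im))/= /qvec dotBr dotZr subr_eq0.
  by move/eqP.
move=> /spaceLP[Sx hL]; split=> //; have /spaceSP[Bx xw] := Sx.
apply/spaceYP; split=> // i; rewrite xw.
have [im|im] := leqP i m; last by rewrite t2// mul0r.
by rewrite /qvec dotBr dotZr hL// subrr mulr0.
Qed.

(** The exponent s is chosen for the truncated sequence t0 that vanishes after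
m; by continuity it still works when these entries are small instead of zero.
It is enough to control the two basis vectors of X. *)
Lemma chain_power m (b t : nat -> R) (d : R) : (forall i, 0 < b i <= 1) ->
  (forall i, (i <= m)%N -> 0 < t i) -> 0 < d ->
  exists s, exists2 rho, 0 < rho & forall t' : nat -> R,
    (forall i, (i <= m)%N -> t' i = t i) ->
    (forall i, (m < i < k)%N -> 0 <= t' i <= rho) ->
    forall x, spaceX x ->
    nrm (iter s (alt spaceS (spaceY b t')) x - proj (spaceL m b) x) <= d * nrm x.
Proof.
move=> hb ht d0; pose t0 i := if (i <= m)%N then t i else 0.
have d4 : 0 < d / 4 by rewrite divr_gt0.
have hlim : spaceS `&` spaceY b t0 = spaceL m b.
  by apply: spaceSY_limit => i im; rewrite /t0 ?im ?gt_eqF ?ht// leqNgt im.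
have [su hsu] := alternating_projections u csub_spaceS (csub_spaceY b t0) d4.
have [sv hsv] := alternating_projections v csub_spaceS (csub_spaceY b t0) d4.
rewrite hlim in hsu hsv.
pose s := maxn su sv; exists s.
(* Each of the s steps is perturbed by at most 2 k (2 rho), as the vectors q have
   length at most 2; c makes the total d / 2. *)
pose c : R := 8 * (s.+1%:R * k.+1%:R).
have c0 : 0 < c by rewrite !mulr_gt0.
exists (d / c); first by rewrite divr_gt0.
move=> t' t'1 t'2 x Xx.
set T0 := alt spaceS (spaceY b t0); set T := alt spaceS _.
have T0L : forall n a y y', iter n T0 (a *: y + y') = a *: iter n T0 y + iter n T0 y'.
  elim=> // n IH a y y'; rewrite !iterS IH /T0 /alt !projL//;
  (exact: csub_spaceS || exact: csub_spaceY).
apply: le_trans (nrm_dist _ _ (iter s T0 x) _) _.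
rewrite [d in _ <= d * _]splitr mulrDl; apply: lerD.
  pose g := 2 * (k%:R * (2 * (d / c))).
  have dc0 : 0 <= d / c by apply/ltW/divr_gt0.
  have g0 : 0 <= g by do 3![apply: mulr_ge0 => //].
  apply: (@le_trans _ _ (s%:R * g * nrm x)).
    apply: (iter_near (D := D) (B := setT)) => //.
    - by move=> y y'; rewrite altB ?alt_le//; (exact: csub_spaceS || exact: csub_spaceY).
    - by move=> y; rewrite alt_le//; (exact: csub_spaceS || exact: csub_spaceY).
    - move=> y _; rewrite /T /T0 /alt; apply: le_trans (proj_dist _ _ csub_spaceS) _.
      apply: le_trans (graph_gap ww _ csub_block _ _ _) _.
      + by move=> i; exact: block_w.
      + by move=> i i'; rewrite dotZr dot_w_qvec mulr0.
      + by move=> i i'; rewrite dotZr dot_w_qvec mulr0.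
      apply: ler_pM; rewrite ?nrm_ge0 ?mulr_ge0 ?sumr_ge0 ?proj_le ?csub_spaceS//.
        by move=> i _; apply: nrm_ge0.
      rewrite ler_wpM2l//; apply: (@le_trans _ _ (\sum_(i < k) 2 * (d / c))).
        apply: ler_sum => i _ /=; rewrite -scalerBl nrmZ mulrC.
        apply: ler_pM; rewrite ?nrm_ge0 ?nrm_qvec//.
          by have /andP[h1 h2] := hb i; rewrite ger0_norm// ltW.
        rewrite /t0; case: leqP => im; first by rewrite t'1// subrr normr0.
        have /andP[h1 h2] : 0 <= t' i <= d / c by apply: t'2; rewrite im ltn_ord.
        by rewrite subr0 ger0_norm.
        by rewrite sumr_const card_ord -[X in X <= _]mulr_natl.
      exact: csub_spaceS.
  rewrite ler_wpM2r ?nrm_ge0// /g.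
  have -> : s%:R * (2 * (k%:R * (2 * (d / c)))) = d / 2 * (s%:R * k%:R / (s.+1%:R * k.+1%:R)).
    have : s.+1%:R * k.+1%:R != 0 :> R by rewrite mulf_neq0 ?pnatr_eq0.
    by rewrite /c; move: (s.+1%:R * _) => m1 m0; field.
  apply: ler_piMr; first by apply/ltW/divr_gt0.
  rewrite ler_pdivrMr ?mulr_gt0// mul1r.
  by apply: ler_pM; rewrite ?ler_nat.
have hu : nrm (iter s T0 u - proj (spaceL m b) u) <= d / 4.
  by apply/ltW/hsu; exact: leq_maxl.
have hv : nrm (iter s T0 v - proj (spaceL m b) v) <= d / 4.
  by apply/ltW/hsv; exact: leq_maxr.
have xu : `|D x u| <= nrm x.
  by apply: le_trans (cauchy_schwarz _ _ _) _; rewrite (nrm1 uu) mulr1.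
have xv : `|D x v| <= nrm x.
  by apply: le_trans (cauchy_schwarz _ _ _) _; rewrite (nrm1 vv) mulr1.
have T0Z n a y : iter n T0 (a *: y) = a *: iter n T0 y.
  elim: n => // n IH; rewrite !iterS IH /T0 /alt !projZ//;
  (exact: csub_spaceS || exact: csub_spaceY).
rewrite [in X in X <= _](spaceX_coord Xx) T0L T0Z projL ?projZ; try exact: csub_spaceL.
rewrite opprD addrACA -!scalerBr.
apply: le_trans (nrmD _ _ _) _; rewrite !nrmZ.
have := nrm_ge0 D x => xn.
have h1 := ler_pM (normr_ge0 _) (nrm_ge0 D _) xu hu.
have h2 := ler_pM (normr_ge0 _) (nrm_ge0 D _) xv hv.
apply: le_trans (lerD h1 h2) _; lra.
Qed.

Definition chain_word s : seq role := flatten (nseq s [:: rS; rY; rS]).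
Definition step_word s p : seq role :=
  flatten (nseq p (rX :: chain_word s ++ [:: rX])).

Lemma act_nseq (P : role -> H -> H) n l x :
  act P (flatten (nseq n l)) x = iter n (act P l) x.
Proof. by elim: n x => //= n IH x; rewrite act_cat IH -iterS iterSr. Qed.

Lemma act_step_word b t s p x :
  act (fun a => proj (ideal b t a)) (step_word s p) x =
  iter p (fun y => proj spaceX (iter s (alt spaceS (spaceY b t)) (proj spaceX y))) x.
Proof.
by rewrite act_nseq; apply: eq_iter => y /=; rewrite -cat1s act_cat act_nseq.
Qed.

Lemma count_step_word s p : count isX (step_word s p) = (2 * p)%N.
Proof.
have c0 n : count isX (chain_word n) = 0%N by elim: n.
elim: p => [|p IH]; first by [].
rewrite -[step_word s p.+1]/((rX :: chain_word s ++ [:: rX]) ++ step_word s p).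
by rewrite count_cat IH /= count_cat c0 mulnS.
Qed.

Hypotheses (al0 : al 0%N = 1) (be0 : be 0%N = 0) (alk : al k = 0) (bek : be k = 1).

(** The bound C on the number of letters X is fixed before rho, the bound on the
parameters t: later on, the error made by each letter X depends on the t of other
blocks.  The sets T i allow additional requirements on the values t i. *)
Theorem quarter_turn (eps : R) : 0 < eps ->
  \sum_(j < k) (1 - (al j * al j.+1 + be j * be j.+1)) <= eps ->
  exists b : nat -> R, exists C : nat, (forall i, 0 < b i <= 1) /\
  forall (T : nat -> set R) (rho : R), 0 < rho ->
    (forall i r, 0 < r -> exists2 x, T i x & 0 < x < r) ->
    exists t : nat -> R, exists word : seq role,
    [/\ forall i, (i < k)%N -> T i (t i) /\ 0 < t i < rho,
        (count isX word <= C)%N &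
        nrm (act (fun a => proj (ideal b t a)) word u - v) <= 2 * eps].
Proof.
move=> eps0 hpath; pose d := eps / (2 * k.+1%:R).
have d0 : 0 < d by rewrite divr_gt0// mulr_gt0.
have /choice[f hf] : forall jx : nat * R, exists pr : nat * R, 0 < pr.2 /\
  forall (jk : (jx.1 < k)%N), 0 < jx.2 -> forall b : nat -> R, b jx.1 = jx.2 ->
    (forall i, (i < jx.1)%N -> 0 <= b i <= pr.2) ->
    nrm (iter pr.1 (alt spaceX (spaceL jx.1 b)) (turn jx.1) -
         D (turn jx.1) (turn jx.1.+1) *: turn jx.1.+1) <= d.
  move=> [j x] /=; have [jk|jk] := ltnP j k; last by exists (0%N, 1).
  have [x0|x0] := ltP 0 x; last by exists (0%N, 1); split=> // _ /(le_lt_trans x0); rewrite ltxx.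
  have [p [r r0 h]] := line_power (Ordinal jk) x0 d0.
  by exists (p, r).
have f2 j x : 0 < x -> 0 < (f (j, x)).2 by move=> _; have [] := hf (j, x).
have [b' hb'] := @choose_increasing R (fun j x => (f (j, x)).2) k 1 f2 ltr01.
pose b i := if (i < k)%N then b' i else 1.
pose p j := (f (j, b j)).1.
have b1 i : 0 < b i <= 1.
  by rewrite /b; case: ltnP => [/hb'[]//|_]; rewrite ltr01 lexx.
exists b, (2 * \sum_(j < k) p j)%N; split=> // T rho rho0 hT.
have hline j : (j < k)%N ->
    nrm (iter (p j) (alt spaceX (spaceL j b)) (turn j) -
         D (turn j) (turn j.+1) *: turn j.+1) <= d.
  move=> jk; have [_] := hf (j, b j); apply=> //=; first by have /andP[] := b1 j.
  move=> i ij; have [] := hb' _ jk; rewrite /b jk (ltn_trans ij jk) => _ h.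
  by rewrite h// andbT ltW//; have [/andP[]] := hb' _ (ltn_trans ij jk).
(* Truncation makes the choice of (s, rho) depend on t only up to index j. *)
pose trunc j (t : nat -> R) := fun i => if (i <= j)%N then t i else 1.
have /choice[g hg] : forall jt : nat * (nat -> R), exists sr : nat * R,
  (forall i, (i <= jt.1)%N -> 0 < jt.2 i) -> 0 < sr.2 /\ forall t' : nat -> R,
    (forall i, (i <= jt.1)%N -> t' i = jt.2 i) ->
    (forall i, (jt.1 < i < k)%N -> 0 <= t' i <= sr.2) ->
    forall x, spaceX x ->
    nrm (iter sr.1 (alt spaceS (spaceY b t')) x - proj (spaceL jt.1 b) x)
      <= d / (p jt.1).+1%:R * nrm x.
  move=> [j t] /=; have [ht|ht] := pselect (forall i, (i <= j)%N -> 0 < t i).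
    have [s [r r0 h]] := chain_power b1 ht (divr_gt0 d0 (ltr0Sn _ (p j))).
    by exists (s, r).
  by exists (0%N, 1).
have g2 j t : (forall i, (i <= j)%N -> 0 < t i) -> 0 < (g (j, trunc j t)).2.
  move=> tj; have [] // := hg (j, trunc j t).
  by move=> i /= ij; rewrite /trunc ij tj.
have gE j t t' : (forall i, (i <= j)%N -> t i = t' i) ->
    (g (j, trunc j t)).2 = (g (j, trunc j t')).2.
  move=> tt'; congr (g (_, _)).2; apply/funext => i; rewrite /trunc.
  by case: leqP => // ij; rewrite tt'.
have [t ht] := @choose_decreasing R T (fun j t => (g (j, trunc j t)).2) k rho hT g2 gE rho0.
have t0 i : (i < k)%N -> 0 < t i by move=> /ht[_ /andP[]].
pose s j := (g (j, trunc j t)).1.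
have hchain j : (j < k)%N -> forall x, spaceX x ->
    nrm (iter (s j) (alt spaceS (spaceY b t)) x - proj (spaceL j b) x)
      <= d / (p j).+1%:R * nrm x.
  move=> jk; have [] := hg (j, trunc j t).
    by move=> i /= ij; rewrite /trunc ij t0// (leq_ltn_trans ij).
  move=> _; apply=> [i /= ij|i /= /andP[ji ik]]; first by rewrite /trunc ij.
  by have [_ /andP[h1 _] h2] := ht _ ik; rewrite ltW//= h2.
pose word m := flatten [seq step_word (s j) (p j) | j <- iota 0 m].
pose Q a := proj (ideal b t a).
have Qle a x : nrm (Q a x) <= nrm x by apply: proj_le; exact: csub_ideal.
have Qdist a x y : nrm (Q a x - Q a y) <= nrm (x - y).
  by apply: proj_dist; exact: csub_ideal.
have wordS m : word m.+1 = word m ++ step_word (s m) (p m).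
  by rewrite /word -addn1 iotaD map_cat flatten_cat /= cats0.
have hstep j : (j < k)%N ->
    nrm (act Q (step_word (s j) (p j)) (turn j) - turn j.+1) <=
    2 * d + (1 - (al j * al j.+1 + be j * be j.+1)).
  move=> jk; rewrite act_step_word.
  apply: le_trans (nrm_dist _ _ (D (turn j) (turn j.+1) *: turn j.+1) _) _.
  apply: lerD; last first.
    rewrite -[X in _ - X]scale1r -scalerBl nrmZ nrm_turn mulr1 -dot_turn.
    rewrite distrC ger0_norm// subr_ge0.
    have := le_trans (ler_norm _) (cauchy_schwarz D (turn j) (turn j.+1)).
    by rewrite !nrm_turn mulr1.
  apply: le_trans (nrm_dist _ _ (iter (p j) (alt spaceX (spaceL j b)) (turn j)) _) _.
  rewrite mulr2n mulrDl mul1r; apply: lerD; last exact: hline.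
  apply: (@le_trans _ _ ((p j)%:R * (d / (p j).+1%:R) * 1)).
    apply: (iter_near (D := D) (B := spaceX)).
    - by apply: divr_ge0 => //; exact: ltW.
    - move=> x y; apply: le_trans (proj_dist _ _ csub_spaceX) _.
      have altd n x' y' : nrm (iter n (alt spaceS (spaceY b t)) x' -
        iter n (alt spaceS (spaceY b t)) y') <= nrm (x' - y').
        elim: n => // n IH; rewrite !iterS altB; try exact: csub_spaceS; last exact: csub_spaceY.
        by apply: le_trans IH; apply: alt_le; [exact: csub_spaceS|exact: csub_spaceY].
      by apply: le_trans (altd _ _ _) _; apply: proj_dist; exact: csub_spaceX.
    - by move=> x Xx; apply: projM; exact: csub_spaceX.
    - by move=> x; apply: alt_le; [exact: csub_spaceX|exact: csub_spaceL].
    - move=> x Xx; rewrite /alt (proj_id csub_spaceX Xx).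
      by apply: le_trans (proj_dist _ _ csub_spaceX) _; exact: hchain.
    - exact: spaceX_turn.
    - by rewrite nrm_turn.
  rewrite mulr1 mulrC -mulrA; apply: ler_piMr; first exact: ltW.
  by rewrite mulrC ler_pdivrMr// mul1r ler_nat.
have hword m : (m <= k)%N -> nrm (act Q (word m) u - turn m) <=
    \sum_(j < m) (2 * d + (1 - (al j * al j.+1 + be j * be j.+1))).
  elim: m => [_|m IH mk].
    by rewrite big_ord0 /= /turn al0 be0 scale1r scale0r addr0 subrr nrm0.
  rewrite big_ord_recr/= wordS act_cat.
  apply: le_trans (nrm_dist _ _ (act Q (step_word (s m) (p m)) (turn m)) _) _.
  apply: lerD; last exact: hstep.
  exact: le_trans (act_dist _ _ _ Qdist) (IH (ltnW mk)).
exists t, (word k); split.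
- by move=> i /ht[].
- suff -> m : count isX (word m) = (2 * \sum_(j < m) p j)%N by [].
  elim: m => [|m IH]; first by rewrite big_ord0.
  by rewrite wordS count_cat IH count_step_word big_ord_recr /= mulnDr.
- have := hword k (leqnn _); rewrite /turn alk bek scale0r scale1r add0r.
  move=> /le_trans; apply; rewrite big_split/= sumr_const card_ord.
  have -> : 2 * eps = eps + eps by ring.
  apply: lerD => //; rewrite -[X in X <= _]mulr_natl /d.
  have -> : k%:R * (2 * (eps / (2 * k.+1%:R))) = eps * (k%:R / k.+1%:R).
    have : k.+1%:R != 0 :> R by rewrite pnatr_eq0.
    by move: (k.+1%:R) => c c0; field.
  apply: ler_piMr; first exact: ltW.
  by rewrite ler_pdivrMr// mul1r ler_nat.
Qed.

End Machine.

(** * Slow paths on the quarter circle *)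

(** The points (k - j, j) of a segment, normalized.  The sine of the angle between
consecutive points is k / (d j * d (j + 1)), where both lengths d are at least
k / sqrt 2; hence each step loses at most 4 / k^2 and all of them at most
4 / k. *)
Lemma slow_path (R : realType) (eps : R) : 0 < eps ->
  exists k, exists al be : nat -> R,
  [/\ (forall j, al j ^+ 2 + be j ^+ 2 = 1),
      [/\ al 0%N = 1, be 0%N = 0, al k = 0 & be k = 1],
      [/\ (1 < k)%N, al 1%N != 0 & be 1%N != 0] &
      \sum_(j < k) (1 - (al j * al j.+1 + be j * be j.+1)) <= eps].
Proof.
move=> eps0; pose k := (Num.Def.truncn (4 / eps)).+2.
have k0 : 0 < k%:R :> R by rewrite ltr0n.
have keps : 4 / k%:R <= eps.
  rewrite ler_pdivrMr// mulrC -ler_pdivrMr//; apply/ltW.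
  by apply: lt_le_trans (truncnS_gt _) _; rewrite ler_nat.
pose x j : R := (k - j)%:R; pose y j : R := j%:R.
have x0 j : 0 <= x j by apply: ler0n.
have y0 j : 0 <= y j by apply: ler0n.
have xy j : k%:R <= x j + y j.
  by rewrite /x /y -natrD ler_nat addnC -leq_subLR.
pose d j := Num.sqrt (x j ^+ 2 + y j ^+ 2).
have d2 j : d j ^+ 2 = x j ^+ 2 + y j ^+ 2.
  by rewrite sqr_sqrtr// addr_ge0// sqr_ge0.
have dk j : k%:R ^+ 2 <= 2 * d j ^+ 2.
  have h : k%:R ^+ 2 <= (x j + y j) ^+ 2.
    by rewrite ler_pXn2r ?nnegrE ?addr_ge0// ltW.
  by rewrite d2; apply: le_trans h _; have := sqr_ge0 (x j - y j); nra.
have d0 j : 0 < d j.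
  rewrite lt_neqAle sqrtr_ge0 andbT eq_sym; apply/eqP => dj.
  by have := dk j; rewrite dj; nra.
have dn0 j : d j != 0 by rewrite gt_eqF.
exists k, (fun j => x j / d j), (fun j => y j / d j); split.
- by move=> j; rewrite !expr_div_n -mulrDl -d2 divff// expf_neq0.
- rewrite /y /x subnn !mul0r subn0; split=> //.
    by rewrite /d /x /y subn0 expr0n addr0 sqrtr_sqr ger0_norm ?divff ?gt_eqF// ltW.
  by rewrite /d /x /y subnn expr0n add0r sqrtr_sqr ger0_norm ?divff ?gt_eqF// ltW.
- by split; rewrite // mulf_neq0 ?invr_eq0// /x /y pnatr_eq0.
apply: le_trans keps; apply: (@le_trans _ _ (\sum_(j < k) 4 / k%:R ^+ 2)); last first.
  rewrite sumr_const card_ord -[X in X <= _]mulr_natl.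
  suff -> : k%:R * (4 / k%:R ^+ 2) = 4 / k%:R :> R by [].
  by have := gt_eqF k0; move: (k%:R) => c /negbT c0; field.
apply: ler_sum => -[j jk] _ /=.
have xS : x j = x j.+1 + 1.
  by rewrite /x natr1 subnSK.
have yS : y j.+1 = y j + 1 by rewrite /y natr1.
have e : x j + y j = k%:R by rewrite /x /y -natrD subnK// ltnW.
have := d2 j; have := d2 j.+1; have := dk j; have := dk j.+1.
have := d0 j; have := d0 j.+1; have := x0 j; have := x0 j.+1; have := y0 j.
rewrite yS xS in e *; move: xS yS.
set a := d j; set b := d j.+1; set X := x j.+1; set Y := y j.
move=> _ _ Y0 X0 X10 b0 a0 bk ak b2 a2.
pose c := ((X + 1) * X + Y * (Y + 1)) / (a * b).
have -> : (X + 1) / a * (X / b) + Y / a * ((Y + 1) / b) = c.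
  by rewrite /c; field; rewrite !gt_eqF.
have ab0 : 0 < a * b by rewrite mulr_gt0.
have c0 : 0 <= c by rewrite divr_ge0 ?(ltW ab0)//; nra.
have c2 : 1 - c ^+ 2 = k%:R ^+ 2 / (a ^+ 2 * b ^+ 2).
  have m0 : a ^+ 2 * b ^+ 2 != 0 by rewrite mulf_neq0// expf_neq0// gt_eqF.
  rewrite /c expr_div_n exprMn -{1}(divff m0) -mulrBl; congr (_ / _).
  by rewrite a2 b2 -e; ring.
have c1 : 1 - c <= 1 - c ^+ 2.
  have : 0 <= 1 - c ^+ 2 by rewrite c2; apply: divr_ge0; [|apply: mulr_ge0]; apply: sqr_ge0.
  rewrite subr_ge0 => c1'; rewrite lerB// expr2 ler_piMl//.
  by rewrite -(ler_pXn2r (n := 2)) ?nnegrE// expr1n.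
apply: le_trans c1 _; rewrite c2.
have K0 : 0 < k%:R ^+ 2 :> R by rewrite exprn_gt0.
have A0 : 0 < a ^+ 2 by rewrite exprn_gt0.
have B0 : 0 < b ^+ 2 by rewrite exprn_gt0.
move: ak bk K0 A0 B0; set K := k%:R ^+ 2; set A := a ^+ 2; set B := b ^+ 2.
move=> ak bk K0 A0 B0.
rewrite ler_pdivrMr ?mulr_gt0// mulrAC ler_pdivlMr//.
have : K * K <= (2 * A) * (2 * B) by apply: ler_pM => //; exact: ltW.
by move=> h; apply: le_trans h _; lra.
Qed.

(** * The chain of blocks *)

(** In even blocks the subspaces 0, 1, 2 play the roles X, S, Y, and in odd
blocks Y, X, S. *)
Definition role_of (p : bool) (j : 'I_3) : role :=
  match p, val j with
  | false, 0%N => rX | false, 1%N => rS | false, _ => rY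
  | true, 0%N => rY | true, 1%N => rX | true, _ => rS
  end.

Definition player (p : bool) (a : role) : 'I_3 :=
  match p, a with
  | false, rX => inord 0 | false, rS => inord 1 | false, rY => inord 2
  | true, rY => inord 0 | true, rX => inord 1 | true, rS => inord 2
  end.

Lemma playerK p a : role_of p (player p a) = a.
Proof. by case: p; case: a; rewrite /role_of /= inordK. Qed.

Section Model.
Variables (R : realType) (H : lmodType R) (D : hilbert H).
Local Notation nrm := (nrm D).
Local Notation proj := (proj D).
Local Notation csub := (csub D).
Variables (k : nat -> nat) (e : nat -> H) (z w : forall n, 'I_(k n) -> H).
Arguments z : clear implicits.
Arguments w : clear implicits.
Hypotheses (ee : forall m n, D (e m) (e n) = (m == n)%:R)
  (zz : forall n i j, D (z n i) (z n j) = (i == j)%:R)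
  (ww : forall n i j, D (w n i) (w n j) = (i == j)%:R)
  (zz0 : forall m n i j, m != n -> D (z m i) (z n j) = 0)
  (ww0 : forall m n i j, m != n -> D (w m i) (w n j) = 0)
  (ez : forall m n i, D (e m) (z n i) = 0)
  (ew : forall m n i, D (e m) (w n i) = 0)
  (zw : forall m n i j, D (z m i) (w n j) = 0).
Variables (a c b t : forall n, 'I_(k n) -> R).
Arguments a : clear implicits.
Arguments c : clear implicits.
Arguments b : clear implicits.
Arguments t : clear implicits.

Definition gvec n i := a n i *: e n.+1 + c n i *: e n.
(** The normal vectors of the subspace playing the role Y in block n. *)
Definition ycons n i := w n i - t n i *: (z n i - b n i *: @gvec n i).
Arguments gvec : clear implicits.
Arguments ycons : clear implicits.

Definition constraints (j : 'I_3) : set H :=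
  [set x | exists n i, match role_of (odd n) j with
    | rX => x = z n i \/ x = w n i
    | rS => x = w n i
    | rY => x = ycons n i end].

Definition basis : set H :=
  [set x | (exists n, x = e n) \/ (exists n i, x = z n i) \/ (exists n i, x = w n i)].

(** Only the trace of X j on the closed span of this chain is prescribed: other
chains contribute further constraints, orthogonal to this span. *)
Variable X : 'I_3 -> set H.
Hypotheses (X_csub : forall j, csub (X j))
  (X_perp : forall j, X j `<=` perp D (constraints j))
  (X_sup : forall j, cspan D basis `&` perp D (constraints j) `<=` X j).
Local Notation P j := (proj (X j)).

Let ze m n i : D (z n i) (e m) = 0. Proof. by rewrite dotC. Qed.
Let we m n i : D (w n i) (e m) = 0. Proof. by rewrite dotC. Qed.
Let wz m n i j : D (w n i) (z m j) = 0. Proof. by rewrite dotC. Qed.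
Let E := (ez, ew, zw, ze, we, wz).

Let cs : csub (cspan D basis). Proof. exact: csub_cspan. Qed.
Lemma span_e n : cspan D basis (e n). Proof. by apply: cspan_gen; left; exists n. Qed.
Lemma span_z n i : cspan D basis (z n i).
Proof. by apply: cspan_gen; right; left; exists n, i. Qed.
Lemma span_w n i : cspan D basis (w n i).
Proof. by apply: cspan_gen; right; right; exists n, i. Qed.

Lemma span_ext x y : cspan D basis x -> cspan D basis y ->
  (forall n, D x (e n) = D y (e n)) -> (forall n i, D x (z n i) = D y (z n i)) ->
  (forall n i, D x (w n i) = D y (w n i)) -> x = y.
Proof.
move=> hx hy xe xz xw; apply/eqP; rewrite -subr_eq0; apply/eqP/(@dot_eq0 _ _ D).
apply: (perp_cspan (F := basis)); last exact: csubB cs hx hy.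
move=> _ [[n ->]|[[n [i ->]]|[n [i ->]]]]; rewrite dotBl ?xe ?xz ?xw subrr//.
Qed.

Lemma dot_ge n i m : D (gvec n i) (e m) = a n i * (n.+1 == m)%:R + c n i * (n == m)%:R.
Proof. by rewrite /gvec dotDl !dotZl !ee. Qed.
Lemma dot_gz n i m j : D (gvec n i) (z m j) = 0.
Proof. by rewrite /gvec dotDl !dotZl !ez; ring. Qed.
Lemma dot_gw n i m j : D (gvec n i) (w m j) = 0.
Proof. by rewrite /gvec dotDl !dotZl !ew; ring. Qed.
Lemma span_g n i : cspan D basis (gvec n i).
Proof.
by apply: (csubD cs); apply: (csubZ _ cs); exact: span_e.
Qed.
Lemma dot_eg n i m : D (e m) (gvec n i) = a n i * (n.+1 == m)%:R + c n i * (n == m)%:R.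
Proof. by rewrite dotC dot_ge. Qed.

Lemma dot_ycons x n i : D x (ycons n i) =
  D x (w n i) - t n i * (D x (z n i) - b n i * D x (gvec n i)).
Proof. by rewrite /ycons dotBr dotZr dotBr dotZr. Qed.

Hypothesis t0 : forall n i, 0 < t n i.

Let in_X j x : cspan D basis x ->
  (forall n i, match role_of (odd n) j with
    | rX => D x (z n i) = 0 /\ D x (w n i) = 0
    | rS => D x (w n i) = 0
    | rY => D x (ycons n i) = 0 end) -> X j x.
Proof.
move=> hx h; apply: X_sup; split=> // y [n [i ]]; have := h n i.
case: role_of; last by move=> h1 ->.
  by move=> [h1 h2] [->|->].
by move=> h1 ->.
Qed.

Let of_X j x n i : X j x -> match role_of (odd n) j with
    | rX => D x (z n i) = 0 /\ D x (w n i) = 0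
    | rS => D x (w n i) = 0
    | rY => D x (ycons n i) = 0 end.
Proof.
move=> /X_perp h; have {}h y := h y.
case r : role_of; first split; apply: h; exists n, i; rewrite r//; [by left|by right].
Qed.

Section Irreducible.
Hypothesis (b0 : forall n i, b n i != 0).
Hypothesis (t_inj : forall n m (i : 'I_(k n)) (j : 'I_(k m)),
  t n i = t m j -> n = m /\ (i = j :> nat)).
Hypothesis (ac1 : forall n i, a n i ^+ 2 + c n i ^+ 2 = 1).
Hypothesis (g_oblique : forall n, exists i, a n i != 0 /\ c n i != 0).
Hypothesis (g_axis : forall n, exists i, a n i = 0).

Variable M : set H.
Hypotheses (M_csub : csub M) (M_span : M `<=` cspan D basis)
  (M_inv : forall j x, M x -> M (P j x)) (M_e0 : ~ M (e 0%N)).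
Local Notation Pi := (proj M).

Let Pi_span x : cspan D basis (Pi x). Proof. by apply: M_span; apply: projM. Qed.

(** A projection commutes with the projections onto X j because both its range M
and the complement of M are invariant under them. *)
Let Pi_comm j x : Pi (P j x) = P j (Pi x).
Proof.
apply: proj_eq => //; first by apply: M_inv; apply: projM.
move=> y My; rewrite -projB// proj_sym// proj_perp//.
exact: M_inv.
Qed.

Let Pi_in j x : X j x -> X j (Pi x).
Proof. by move=> /(proj_id (X_csub j)) <-; rewrite Pi_comm; apply: projM. Qed.

Let Pi_out j x y : (forall y, X j y -> D x y = 0) -> X j y -> D (Pi x) y = 0.
Proof.
move=> /(proj_perp0 (X_csub j)) h Xy.
have : P j (Pi x) = 0 by rewrite -Pi_comm h proj0.
by move=> h'; rewrite -(proj_dot _ (X_csub j) Xy) h' dot0l.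
Qed.

Let out_constraints j x : constraints j x -> forall y, X j y -> D x y = 0.
Proof. by move=> hx y /X_perp h; rewrite dotC h. Qed.

Let j0 : 'I_3 := inord 0.
Let j1 : 'I_3 := inord 1.
Let j2 : 'I_3 := inord 2.

Let rE p : role_of p j0 = (if p then rY else rX).
Proof. by case: p; rewrite /role_of /j0 /= inordK. Qed.
Let rE1 p : role_of p j1 = (if p then rX else rS).
Proof. by case: p; rewrite /role_of /j1 /= inordK. Qed.
Let rE2 p : role_of p j2 = (if p then rS else rY).
Proof. by case: p; rewrite /role_of /j2 /= inordK. Qed.

Let X1_e m : X j1 (e m).
Proof. by apply: in_X => [|n i]; [exact: span_e|rewrite rE1; case: odd; rewrite !E]. Qed.

Let X1_z n i : ~~ odd n -> X j1 (z n i).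
Proof.
move=> on; apply: in_X => [|m j]; [exact: span_z|rewrite rE1].
case: ifPn => om; rewrite !E//; split=> //; rewrite zz0//.
by apply: contraNneq on => ->.
Qed.

Let X2_z n i : odd n -> X j2 (z n i).
Proof.
move=> on; apply: in_X => [|m j]; [exact: span_z|rewrite rE2].
case: ifPn => om; first by rewrite !E.
rewrite dot_ycons !E zz0; last by apply: contraNneq om => <-.
by rewrite dotC dot_gz; ring.
Qed.

(** The subspace that plays the role Y in the blocks of parity p. *)
Let jY p := player p rY.

Let XY_out n i y : X (jY (odd n)) y -> D (Pi (ycons n i)) y = 0.
Proof.
by apply/Pi_out/out_constraints; exists n, i; rewrite playerK.
Qed.

Let XYE p q : role_of q (jY p) = if q == p then rY else if q then rS else rX.
Proof. by rewrite /jY /player /role_of; case: p; case: q; rewrite /= inordK. Qed.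

Let XY_zw n i : X (jY (odd n)) (z n i + t n i *: w n i).
Proof.
apply: in_X => [|m j].
  exact: (csubD cs (span_z _) (csubZ _ cs (span_w _))).
have [nm|nm] := eqVneq n m.
  subst m; rewrite XYE eqxx dot_ycons !dotDl !dotZl !E zz ww (dotC D _ (gvec _ _)) dot_gz.
  by rewrite (dotC D (w _ _) (gvec _ _)) dot_gw; case: eqP => [->|_] /=; ring.
rewrite XYE; case: eqP => _; last first.
  case: ifP => _; rewrite !dotDl !dotZl !E ?zz0 ?ww0// ?mulr0 ?addr0//.
rewrite dot_ycons !dotDl !dotZl !E zz0// ww0// (dotC D _ (gvec _ _)) dot_gz.
rewrite (dotC D (w _ _) (gvec _ _)) dot_gw; ring.
Qed.

(** The vector e m completed by z coordinates so as to satisfy the constraints of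
role Y in all blocks of parity p; at most one block contributes, the sum over all
n <= m avoids singling it out. *)
Let lift p m := e m + \sum_(n < m.+1 | odd n == p) \sum_(i < k n)
  (b n i * D (e m) (gvec n i)) *: z n i.

Let lift_e p m n : D (lift p m) (e n) = (m == n)%:R.
Proof.
rewrite /lift dotDl ee dot_suml big1 ?addr0// => l _.
by rewrite dot_suml big1// => i _; rewrite dotZl !E mulr0.
Qed.
Let lift_w p m n i : D (lift p m) (w n i) = 0.
Proof.
rewrite /lift dotDl !E dot_suml big1 ?addr0// => l _.
by rewrite dot_suml big1// => j _; rewrite dotZl !E mulr0.
Qed.
Let lift_z p m n i : D (lift p m) (z n i) =
  if odd n == p then b n i * D (e m) (gvec n i) else 0.
Proof.
rewrite /lift dotDl !E add0r dot_suml.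
have zero l : l != n -> D (\sum_(i < k l) (b l i * D (e m) (gvec l i)) *: z l i) (z n i) = 0.
  by move=> ln; rewrite dot_suml big1// => j _; rewrite dotZl zz0// mulr0.
case: ifPn => on; last first.
  by rewrite big1// => l lp; apply: zero; apply: contraNneq on => <-.
have [nm|mn] := leqP n m.
  rewrite (bigD1 (Ordinal (nm : (n < m.+1)%N)))//= [X in _ + X]big1 ?addr0; last first.
    by move=> l /andP[_ ln]; apply: zero.
  rewrite dot_suml (bigD1 i)//= dotZl zz eqxx mulr1 big1 ?addr0// => j ji.
  by rewrite dotZl zz (negPf ji) mulr0.
rewrite big1 => [|l _]; last by apply: zero; rewrite ltn_eqF// (leq_trans (ltn_ord l)).
by rewrite dot_eg !gtn_eqF// ?mulr0 ?addr0 ?mulr0//; rewrite ltnS ltnW.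
Qed.

Let lift_span p m : cspan D basis (lift p m).
Proof.
rewrite /lift; apply: (csubD cs (span_e _)).
apply: (csub_sum _ cs) => l _; apply: (csub_sum _ cs) => i _.
exact: (csubZ _ cs (span_z _)).
Qed.

Let lift_g p m n i : D (lift p m) (gvec n i) = D (e m) (gvec n i).
Proof. by rewrite /gvec !dotDr !dotZr !lift_e !ee. Qed.

Let XY_lift p m : X (jY p) (lift p m).
Proof.
apply: in_X => // n i; rewrite XYE; case: ifPn => [/eqP on|on].
  by rewrite dot_ycons lift_w lift_z on eqxx lift_g; ring.
by case: ifP => _; rewrite lift_w// lift_z (negPf on).
Qed.

Let jY2 : jY false = j2. Proof. by []. Qed.

(** The next lemmas show that Pi respects the kind of a basis vector: the images
of the e only have e coordinates, and the images of the z (the w) only have z (w)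
coordinates, in blocks of the same parity.  They follow from the
fact that Pi x lies in X j, or in its complement, whenever x does. *)
Let Pi_z_even n i : ~~ odd n ->
  [/\ forall m, D (Pi (z n i)) (e m) = 0,
      forall m j, odd m -> D (Pi (z n i)) (z m j) = 0 &
      forall m j, D (Pi (z n i)) (w m j) = 0].
Proof.
move=> on; have hX := Pi_in (X1_z i on).
have hz m j : odd m -> D (Pi (z n i)) (z m j) = 0.
  by move=> om; have := of_X j hX; rewrite rE1 om => -[].
split=> // [m|m j]; last first.
  by have := of_X j hX; rewrite rE1; case: ifP => // _ [].
have hout : forall y, X j0 y -> D (z n i) y = 0.
  apply: out_constraints; exists n, i; rewrite rE (negPf on); by left.
have := Pi_out hout (XY_lift true m).
rewrite {1}/lift dotDr dot_sumr big1 ?addr0// => l /eqP ol.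
by rewrite dot_sumr big1// => j _; rewrite dotZr hz ?ol ?mulr0.
Qed.

Let Pi_w_odd n i : odd n ->
  [/\ forall m, D (Pi (w n i)) (e m) = 0,
      forall m j, D (Pi (w n i)) (z m j) = 0 &
      forall m j, ~~ odd m -> D (Pi (w n i)) (w m j) = 0].
Proof.
move=> on.
have out1 : forall y, X j1 y -> D (w n i) y = 0.
  by apply: out_constraints; exists n, i; rewrite rE1 on; right.
have out2 : forall y, X j2 y -> D (w n i) y = 0.
  by apply: out_constraints; exists n, i; rewrite rE2 on.
have hz m j : D (Pi (w n i)) (z m j) = 0.
  by case om : (odd m); [exact: Pi_out out2 (X2_z _ _)|apply: Pi_out out1 (X1_z _ _); rewrite om].
split=> // [m|m j om]; first exact: Pi_out out1 (X1_e m).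
have := Pi_out (j := j2) out2; rewrite -jY2 -(negPf om) => /(_ _ (XY_zw j)).
rewrite dotDr hz add0r dotZr => /eqP; rewrite mulf_eq0 gt_eqF//= => /eqP//.
Qed.

Let Pi_sym x y : D (Pi x) y = D x (Pi y). Proof. exact: proj_sym. Qed.

Let Pi_ew m n i : D (Pi (e m)) (w n i) = 0.
Proof. by have := of_X i (Pi_in (X1_e m)); rewrite rE1; case: ifP => // _ []. Qed.
Let Pi_ez m n i : D (Pi (e m)) (z n i) = 0.
Proof.
case on : (odd n); first by have := of_X i (Pi_in (X1_e m)); rewrite rE1 on => -[].
by rewrite Pi_sym dotC; have [|h _ _] := @Pi_z_even n i; rewrite ?on.
Qed.
Let Pi_gw m l n i : D (Pi (gvec m l)) (w n i) = 0.
Proof. by rewrite /gvec projD// !projZ// dotDl !dotZl !Pi_ew; ring. Qed.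
Let Pi_gz m l n i : D (Pi (gvec m l)) (z n i) = 0.
Proof. by rewrite /gvec projD// !projZ// dotDl !dotZl !Pi_ez; ring. Qed.

Let Pi_ycons n i y : D (Pi (ycons n i)) y =
  D (Pi (w n i)) y - t n i * (D (Pi (z n i)) y - b n i * D (Pi (gvec n i)) y).
Proof. by rewrite /ycons projB// projZ// projB// projZ// dotBl dotZl dotBl dotZl. Qed.

(** The only pair of kinds for which this is not immediate is z odd, w even: the
constraint vector of the even block is orthogonal to subspace 2, which contains
the odd z vectors. *)
Let Pi_zw m n i j : D (Pi (z m i)) (w n j) = 0.
Proof.
case om : (odd m); last by have [|_ _ h] := @Pi_z_even m i; rewrite ?om.
case on : (odd n).
  by rewrite Pi_sym dotC; have [_ h _] := @Pi_w_odd n j on; apply: h.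
have := XY_out j; rewrite on jY2 => /(_ _ (X2_z i om)).
rewrite Pi_ycons Pi_gz.
have [|_ -> // _] := @Pi_z_even n j; first by rewrite on.
by rewrite mulr0 subrr mulr0 subr0 dotC Pi_sym.
Qed.

Let Pi_zz m n i j : odd m != odd n -> D (Pi (z m i)) (z n j) = 0.
Proof.
case om : (odd m); case on : (odd n) => // _; last first.
  by have [|_ h _] := @Pi_z_even m i; rewrite ?om// h.
by rewrite Pi_sym dotC; have [|_ h _] := @Pi_z_even n j; rewrite ?on// h.
Qed.
Let Pi_ww m n i j : odd m != odd n -> D (Pi (w m i)) (w n j) = 0.
Proof.
case om : (odd m); case on : (odd n) => // _.
  by have [_ _ h] := @Pi_w_odd m i om; rewrite h// on.
by rewrite Pi_sym dotC; have [_ _ h] := @Pi_w_odd n j on; rewrite h// om.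
Qed.
Let Pi_wz m n i j : D (Pi (w m i)) (z n j) = 0.
Proof. by rewrite Pi_sym dotC Pi_zw. Qed.
Let Pi_we m n i : D (Pi (w m i)) (e n) = 0.
Proof. by rewrite Pi_sym dotC Pi_ew. Qed.
Let Pi_ze m n i : D (Pi (z m i)) (e n) = 0.
Proof. by rewrite Pi_sym dotC Pi_ez. Qed.

(** Within one parity, testing Pi of a constraint vector against z + t w gives
t2 <Pi w1, w2> = t1 <Pi z1, z2> for any two indices.  The two matrices are
symmetric, so (t1^2 - t2^2) <Pi w1, w2> = 0 and distinct parameters make Pi
diagonal.  Testing against the lifted e m transfers the eigenvalue to g. *)
Let Pi_diag n i : exists s, [/\ Pi (w n i) = s *: w n i, Pi (z n i) = s *: z n i &
  Pi (gvec n i) = s *: gvec n i].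
Proof.
have rel n1 n2 (i1 : 'I_(k n1)) (i2 : 'I_(k n2)) : odd n1 = odd n2 ->
    t n2 i2 * D (Pi (w n1 i1)) (w n2 i2) = t n1 i1 * D (Pi (z n1 i1)) (z n2 i2).
  move=> on; have := XY_out i1; rewrite on => /(_ _ (XY_zw i2)).
  rewrite dotDr dotZr !Pi_ycons Pi_wz Pi_zw !Pi_gz !Pi_gw => h.
  by apply/eqP; rewrite -subr_eq0 -h; apply/eqP; ring.
have off n1 n2 (i1 : 'I_(k n1)) (i2 : 'I_(k n2)) : t n1 i1 != t n2 i2 ->
    D (Pi (w n1 i1)) (w n2 i2) = 0 /\ D (Pi (z n1 i1)) (z n2 i2) = 0.
  move=> tn; case: (eqVneq (odd n1) (odd n2)) => on; last by rewrite Pi_ww ?Pi_zz.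
  have h1 := rel _ _ i1 i2 on; have h2 := rel _ _ i2 i1 (esym on).
  rewrite Pi_sym dotC [D (Pi (z n2 _)) _]Pi_sym [D (z n2 _) _]dotC in h2.
  have p1 := t0 i1; have p2 := t0 i2.
  move: h1 h2; set x := D _ _; set y := D _ _ => h1 h2.
  have x0 : x = 0.
    have : (t n1 i1 - t n2 i2) * ((t n1 i1 + t n2 i2) * x) = 0.
      transitivity (t n1 i1 * (t n1 i1 * x) - t n2 i2 * (t n2 i2 * x)); first by ring.
      by rewrite h1 h2; ring.
    move/eqP; rewrite mulf_eq0 subr_eq0 (negPf tn)/= mulf_eq0 gt_eqF ?addr_gt0//=.
    by move/eqP.
  split=> //; move: h1; rewrite x0 mulr0 => /esym/eqP.
  by rewrite mulf_eq0 gt_eqF//= => /eqP.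
pose s := D (Pi (w n i)) (w n i).
have ss : D (Pi (z n i)) (z n i) = s.
  have /eqP := rel _ _ i i erefl; rewrite -subr_eq0 -mulrBr mulf_eq0 gt_eqF//=.
  by rewrite subr_eq0 => /eqP.
have sw : Pi (w n i) = s *: w n i.
  apply: span_ext => // [|m|m j|m j].
  - exact: (csubZ _ cs (span_w _)).
  - by rewrite Pi_we dotZl !E mulr0.
  - by rewrite Pi_wz dotZl !E mulr0.
  - rewrite dotZl; case: (eqVneq (t n i) (t m j)) => tij.
      by case: (t_inj tij) => nm; subst m => /val_inj <-; rewrite ww eqxx mulr1.
    have [-> _] := off _ _ _ _ tij.
    case: (eqVneq n m) => nm; last by rewrite ww0// mulr0.
    subst m; rewrite ww; case: eqP => [ij|]; last by rewrite mulr0.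
    by rewrite ij eqxx in tij.
have sz : Pi (z n i) = s *: z n i.
  apply: span_ext => // [|m|m j|m j].
  - exact: (csubZ _ cs (span_z _)).
  - by rewrite Pi_ze dotZl !E mulr0.
  - rewrite dotZl; case: (eqVneq (t n i) (t m j)) => tij.
      by case: (t_inj tij) => nm; subst m => /val_inj <-; rewrite zz eqxx mulr1.
    have [_ ->] := off _ _ _ _ tij.
    case: (eqVneq n m) => nm; last by rewrite zz0// mulr0.
    subst m; rewrite zz; case: eqP => [ij|]; last by rewrite mulr0.
    by rewrite ij eqxx in tij.
  - by rewrite Pi_zw dotZl !E mulr0.
exists s; split=> //.
apply: span_ext => // [|m|m j|m j].
- exact: (csubZ _ cs (span_g _)).
- have := XY_out i (XY_lift (odd n) m).
  rewrite Pi_ycons sw sz !dotZl [D (w _ _) _]dotC lift_w [D (z _ _) _]dotC lift_z eqxx.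
  have -> : D (Pi (gvec n i)) (lift (odd n) m) = D (Pi (gvec n i)) (e m).
    rewrite {1}/lift dotDr dot_sumr big1 ?addr0// => l _.
    by rewrite dot_sumr big1// => j _; rewrite dotZr Pi_gz mulr0.
  rewrite (dotC D (e m)) => h.
  have : t n i * b n i * (D (Pi (gvec n i)) (e m) - s * D (gvec n i) (e m)) = 0.
    by rewrite -[RHS]h; ring.
  move/eqP; rewrite mulf_eq0 mulf_eq0 gt_eqF//= (negPf (b0 _))/= subr_eq0.
  by move/eqP.
- by rewrite Pi_gz dotZl dot_gz mulr0.
- by rewrite Pi_gw dotZl dot_gw mulr0.
Qed.

(** The vector Pi e_0 lies in subspaces 0 and 1, as e_0 does.  In odd blocks these
play the roles Y and X, so Pi e_0 is orthogonal to all g there, hence to e_1, e_2,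
...: it is a multiple of e_0. *)
Let Pi_e0 : Pi (e 0%N) = 0.
Proof.
set v := Pi (e 0%N).
have v_span : cspan D basis v by exact: Pi_span.
have h0 : X j0 v.
  apply: Pi_in; apply: in_X => [|n i]; [exact: span_e|rewrite rE].
  case: ifP => on; rewrite ?dot_ycons !E//.
  rewrite dot_eg; case: n on i => // n _ i.
  by rewrite /=; ring.
have vg n i : odd n -> D v (gvec n i) = 0.
  move=> on; have := of_X i h0; rewrite rE on dot_ycons Pi_ez Pi_ew => h.
  have : t n i * b n i * D v (gvec n i) = 0 by rewrite -[RHS]h; ring.
  by move/eqP; rewrite mulf_eq0 mulf_eq0 gt_eqF//= (negPf (b0 _))/= => /eqP.
have ve n : odd n -> D v (e n) = 0 /\ D v (e n.+1) = 0.
  move=> on; have [i ai] := g_axis n; have [i' [ai' ci']] := g_oblique n.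
  have vn : D v (e n) = 0.
    have := vg n i on; rewrite /gvec ai scale0r add0r dotZr => /eqP.
    rewrite mulf_eq0 => /orP[/eqP ci|/eqP//].
    by have := ac1 i; rewrite ai ci expr0n add0r => /eqP; rewrite eq_sym oner_eq0.
  split=> //; have := vg n i' on; rewrite /gvec dotDr !dotZr vn mulr0 addr0 => /eqP.
  by rewrite mulf_eq0 (negPf ai')/= => /eqP.
have vE : v = D v (e 0%N) *: e 0%N.
  apply: span_ext => // [|m|m j|m j].
  - exact: (csubZ _ cs (span_e _)).
  - rewrite dotZl ee; case: m => [|m]; first by rewrite eqxx mulr1.
    rewrite mulr0; case om : (odd m); first by have [_] := ve _ om.
    by have [] := ve m.+1; rewrite /= ?om.
  - by rewrite Pi_ez dotZl !E mulr0.
  - by rewrite Pi_ew dotZl !E mulr0.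
have vv : Pi v = v by apply: proj_id => //; apply: projM.
have : (D v (e 0%N) - 1) *: v = 0.
  have h : Pi v = D v (e 0%N) *: v by rewrite {1}vE projZ.
  by rewrite scalerBl scale1r -h vv subrr.
move/eqP; rewrite scaler_eq0 subr_eq0 => /orP[/eqP v1|/eqP//].
by case: M_e0; rewrite v1 scale1r in vE; rewrite -vE; apply: projM.
Qed.

(** An oblique g in block n has a component along e n, where Pi vanishes; its
eigenvalue is therefore 0, and its component along e (n+1) is killed as well. *)
Let Pi_e n : Pi (e n) = 0.
Proof.
elim: n => [|n IH]; first exact: Pi_e0.
have [i [ai ci]] := g_oblique n; have [s [_ _ sg]] := Pi_diag i.
have : D (Pi (gvec n i)) (e n) = 0 by rewrite Pi_sym IH dot0r.
rewrite sg dotZl dot_ge eqxx gtn_eqF// mulr0 add0r mulr1 => /eqP.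
rewrite mulf_eq0 (negPf ci) orbF => /eqP s0.
move: sg; rewrite s0 scale0r /gvec projD// !projZ// IH scaler0 addr0 => /eqP.
by rewrite scaler_eq0 (negPf ai)/= => /eqP.
Qed.

Theorem invariant_trivial x : M x -> x = 0.
Proof.
move=> Mx; have Pizw n i : Pi (z n i) = 0 /\ Pi (w n i) = 0.
  have [s [-> -> sg]] := Pi_diag i.
  have : Pi (gvec n i) = 0 by rewrite /gvec projD// !projZ// !Pi_e !scaler0 addr0.
  rewrite sg => /eqP; rewrite scaler_eq0 => /orP[/eqP ->|/eqP g0]; first by rewrite !scale0r.
  have := ac1 i; have := dot_ge i n; have := dot_ge i n.+1; rewrite g0 !dot0l.
  rewrite !eqxx ltn_eqF// gtn_eqF// => h1 h2.
  have -> : a n i = 0 by rewrite [RHS]h1 /=; ring.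
  have -> : c n i = 0 by rewrite [RHS]h2 /=; ring.
  by rewrite expr0n addr0 => /eqP; rewrite eq_sym oner_eq0.
have xE : Pi x = x by apply: proj_id.
apply: span_ext => [||n|n i|n i]; [exact: M_span|exact: csub0 (csub_cspan _ _)|..];
  rewrite dot0l -xE Pi_sym.
- by rewrite Pi_e dot0r.
- by have [-> _] := Pizw n i; rewrite dot0r.
- by have [_ ->] := Pizw n i; rewrite dot0r.
Qed.

End Irreducible.

Section Near.
Hypothesis (b1 : forall n i, `|b n i| <= 1).
Hypothesis (ac1 : forall n i, a n i ^+ 2 + c n i ^+ 2 = 1).
Variables (n : nat) (I : role -> set H).
Let B := block D (e n) (e n.+1) (z n) (w n).
Hypothesis (I_csub : forall r, csub (I r)).
Hypothesis (IP : forall r x, I r x <-> B x /\ forall i, match r with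
  | rX => D x (z n i) = 0 /\ D x (w n i) = 0
  | rS => D x (w n i) = 0
  | rY => D x (ycons n i) = 0 end).

Let cB : csub B. Proof. exact: csub_block. Qed.

Let B_perp x y : perp D ([set e n; e n.+1] `|` range (z n) `|` range (w n)) y ->
  B x -> D x y = 0.
Proof. by move=> hy Bx; rewrite dotC; apply: perp_cspan hy Bx. Qed.

Let B_z m i x : m != n -> B x -> D x (z m i) = 0.
Proof.
move=> mn; apply: B_perp => _ [[[->|->]|[j _ <-]]|[j _ <-]]; rewrite ?E// zz0//.
Qed.
Let B_w m i x : m != n -> B x -> D x (w m i) = 0.
Proof.
move=> mn; apply: B_perp => _ [[[->|->]|[j _ <-]]|[j _ <-]]; rewrite ?E// ww0//.
Qed.
Let B_e m x : m != n -> m != n.+1 -> B x -> D x (e m) = 0.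
Proof.
move=> mn mn1; apply: B_perp => _ [[[->|->]|[j _ <-]]|[j _ <-]]; rewrite ?E// ee.
  by rewrite (negPf mn).
by rewrite (negPf mn1).
Qed.

Let nbr m := (m == n.+1) || (m.+1 == n).

Let B_g m i x : m != n -> ~~ nbr m -> B x -> D x (gvec m i) = 0.
Proof.
rewrite negb_or => mn /andP[m1 m2] Bx; rewrite /gvec dotDr !dotZr !B_e//.
by ring.
Qed.

Let B_span x : B x -> cspan D basis x.
Proof.
apply: perp_sub; apply: perp_sub => _ [[[->|->]|[j _ <-]]|[j _ <-]].
- by left; exists n.
- by left; exists n.+1.
- by right; left; exists n, j.
- by right; right; exists n, j.
Qed.

Let B_gen_e0 : B (e n). Proof. exact: block_u. Qed.
Let B_gen_e1 : B (e n.+1). Proof. exact: block_v. Qed.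
Let B_gen_z i : B (z n i). Proof. exact: block_z. Qed.
Let B_gen_w i : B (w n i). Proof. exact: block_w. Qed.
Let B_ycons i : B (ycons n i).
Proof.
apply: (csubB cB) => //; apply: (csubZ _ cB); apply: (csubB cB) => //.
by apply: (csubZ _ cB); apply: (csubD cB); apply: (csubZ _ cB).
Qed.

(** The disturbance caused in block n by the two neighbouring blocks. *)
Definition drift := 2 * \sum_(m < n.+2 | (m == n.+1 :> nat) || (m.+1 == n :> nat))
  \sum_(i < k m) t m i.
(** Only the subspace playing the role Y in the neighbouring blocks feels them. *)
Definition cost r := if role_of (~~ odd n) (player (odd n) r) is rY then drift else 0.

Let q m (i : 'I_(k m)) := z m i - b m i *: gvec m i.
Arguments q : clear implicits.
Let nrm_q m i : nrm (q m i) <= 2.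
Proof.
have nz : nrm (z m i) = 1 by rewrite nrm1// zz eqxx.
have ng : nrm (gvec m i) = 1.
  rewrite nrm1// /gvec !dotE !ee !eqxx (ltn_eqF (ltnSn m)) (gtn_eqF (ltnSn m)).
  by rewrite -[RHS](ac1 i) /=; ring.
apply: le_trans (nrmD _ _ _) _; rewrite nrmN nrmZ ng nz mulr1.
by have := b1 i; lra.
Qed.

(** The w components, taken in the neighbouring blocks, that a vector of block n
lacks in order to satisfy the constraints of role Y there. *)
Let shift y := \sum_(m < n.+2 | nbr m) \sum_(i < k m) (t m i * D y (q m i)) *: w m i.

Let dot_shift y x : (forall m i, nbr m -> D (w m i) x = 0) -> D (shift y) x = 0.
Proof.
move=> h; rewrite /shift dot_suml big1// => m nm.
by rewrite dot_suml big1// => i _; rewrite dotZl h// mulr0.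
Qed.

Let dot_shift_w y m i : nbr m -> D (shift y) (w m i) = t m i * D y (q m i).
Proof.
move=> nm; have mn : (m < n.+2)%N by move: nm => /orP[/eqP ->//|/eqP <-]; rewrite ltnS ltnW.
rewrite /shift dot_suml (bigD1 (Ordinal mn))//= [X in _ + X]big1 ?addr0; last first.
  move=> l /andP[_ ln]; rewrite dot_suml big1// => j _; rewrite dotZl ww0 ?mulr0//.
rewrite dot_suml (bigD1 i)//= dotZl ww eqxx mulr1 big1 ?addr0// => j ji.
by rewrite dotZl ww (negPf ji) mulr0.
Qed.

Let odd_nbr m : nbr m -> odd m = ~~ odd n.
Proof. by move=> /orP[/eqP ->//|/eqP <- /=]; rewrite negbK. Qed.

Let nrm_shift y : nrm (shift y) <= drift * nrm y.
Proof.
apply: le_trans (nrm_sum _ _ _ _) _; rewrite /drift mulr_sumr mulr_suml.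
apply: ler_sum => m _; apply: le_trans (nrm_sum _ _ _ _) _.
rewrite mulr_sumr mulr_suml; apply: ler_sum => i _.
rewrite nrmZ (nrm1 (x := w m i)) ?ww ?eqxx// mulr1 normrM gtr0_norm ?t0//.
rewrite (mulrC 2) -mulrA; apply: ler_wpM2l; first exact: ltW.
apply: le_trans (cauchy_schwarz _ _ _) _; rewrite mulrC.
by apply: ler_wpM2r; rewrite ?nrm_ge0.
Qed.

(** With y the ideal projection of x, the difference x - y is orthogonal to
subspace j because the constraints of block n hold there, and y becomes a vector
of subspace j after adding the missing w components. *)
Lemma proj_near_ideal r x : B x ->
  nrm (P (player (odd n) r) x - proj (I r) x) <= cost r * nrm x.
Proof.
move=> Bx; set j := player _ _; set y := proj (I r) x.
have Iy : I r y by apply: projM.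
have /IP[By hy] := Iy.
have xy v : X j v -> D (x - y) v = 0.
  move=> Xv; have Bxy : B (x - y) by apply: (csubB cB).
  rewrite dotC -(proj_dot v cB Bxy) dotC; apply: proj_perp => //.
  apply/IP; split=> [|i]; first exact: projM.
  have := of_X i Xv; rewrite playerK.
  by case: (r); rewrite ?(proj_dot _ cB (B_gen_z i)) ?(proj_dot _ cB (B_gen_w i))
    ?(proj_dot _ cB (B_ycons i)).
pose s := if role_of (~~ odd n) j is rY then shift y else 0.
have s_perp u : (forall m i, nbr m -> D (w m i) u = 0) -> D s u = 0.
  by move=> hu; rewrite /s; case: role_of; rewrite ?dot0l// dot_shift.
have s_le : nrm s <= cost r * nrm x.
  rewrite /s /cost -/j; case: role_of; rewrite ?nrm0 ?mul0r//.
  apply: le_trans (nrm_shift _) _; apply: ler_wpM2l; last exact: proj_le.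
  apply: mulr_ge0 => //; apply: sumr_ge0 => m _; apply: sumr_ge0 => i _; exact: ltW.
suff Xs : X j (y + s).
  apply: le_trans s_le; rewrite nrmB; apply: le_trans (proj_near (I_csub r) (X_csub j) xy Xs) _.
  by rewrite -/y opprD addrA subrr add0r nrmN.
have s_span : cspan D basis s.
  rewrite /s; case: role_of; try exact: csub0 cs.
  apply: (csub_sum _ cs) => m _; apply: (csub_sum _ cs) => i _.
  by apply: (csubZ _ cs); exact: span_w.
have w_n m m' i i' : nbr m -> odd m' = odd n -> D (w m i) (w m' i') = 0.
  by move=> /odd_nbr om om'; rewrite ww0//; apply/eqP => mm; move: om; rewrite mm om'; case: odd.
have s_z m i : D s (z m i) = 0 by apply: s_perp => *; rewrite !E.
have s_g m i : D s (gvec m i) = 0.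
  by apply: s_perp => *; rewrite dotC dot_gw.
have s_w m i : odd m = odd n -> D s (w m i) = 0.
  by move=> om; apply: s_perp => m' i' nm; apply: w_n.
have s_c m i : odd m = odd n -> D s (ycons m i) = 0.
  by move=> om; rewrite dot_ycons s_w// s_z s_g; ring.
apply: in_X => [|m i]; first by apply: (csubD cs) => //; exact: B_span.
have [mn|mn] := eqVneq m n.
  subst m; have := hy i; rewrite playerK; case: (r).
  - by rewrite !dotDl s_z s_w// => -[-> ->]; rewrite addr0.
  - by rewrite !dotDl s_w// => ->; rewrite addr0.
  - by rewrite !dotDl s_c// => ->; rewrite addr0.
have yz : D y (z m i) = 0 by apply: B_z.
have yw : D y (w m i) = 0 by apply: B_w.
case: (eqVneq (odd m) (odd n)) => om.
  rewrite !dotDl s_z s_w// s_c// yz yw !addr0 dot_ycons yz yw B_g//.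
    by case: role_of => //; ring.
  by apply/negP => /odd_nbr; rewrite om; case: odd.
have {}om : odd m = ~~ odd n by move: om; do 2 case: odd.
move: s_z s_g s_perp; rewrite om /s; case: role_of => s_z s_g s_perp.
- by rewrite addr0.
- by rewrite addr0.
rewrite dot_ycons !dotDl yw yz s_z s_g.
case nm : (nbr m).
  by rewrite dot_shift_w// /q dotBr dotZr yz; ring.
rewrite B_g ?nm// s_perp; first by ring.
by move=> m' i' nm'; rewrite ww0//; apply: contraFneq nm => <-.
Qed.

End Near.
End Model.

(** * Orbits that are not Cauchy *)

Section Orbits.
Variables (R : realType) (H : lmodType R) (D : hilbert H).
Local Notation nrm := (nrm D).

Fixpoint orbit (P : 'I_3 -> H -> H) (s : nat -> 'I_3) x n : H :=
  if n is m.+1 then P (s n) (orbit P s x m) else x.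

Lemma orbit_act (P : 'I_3 -> H -> H) s x (l : seq 'I_3) :
  (forall i, (i < size l)%N -> s i.+1 = nth ord0 l i) ->
  orbit P s x (size l) = act P l x.
Proof.
elim/last_ind: l => [//|l a IH] h.
rewrite size_rcons -cats1 act_cat /= IH => [|i il].
  by rewrite h ?size_rcons// nth_rcons ltnn eqxx.
by rewrite h ?nth_rcons ?il// size_rcons; apply: ltnW.
Qed.

Lemma orbit_shift (P : 'I_3 -> H -> H) j s x n :
  orbit P (fun i => if i is i'.+2 then s i'.+1 else j) x n.+1 =
  orbit P s (P j x) n.
Proof. by elim: n => //= n <-. Qed.

(** Since consecutive points x n are at distance at least 1 and the accumulated
error stays below 1/4, the iterates at the ends of consecutive words are at
distance at least 1/2. *)
Lemma orbit_not_cauchy (P : 'I_3 -> H -> H) (x : nat -> H)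
    (W : nat -> seq 'I_3) (d : nat -> R) :
  (forall j x y, nrm (P j x - P j y) <= nrm (x - y)) ->
  (forall n, nrm (act P (W n) (x n) - x n.+1) <= d n) ->
  (forall n, 0 <= d n) ->
  (forall N, \sum_(n < N) d n <= 1 / 4) ->
  (forall n, 1 <= nrm (x n - x n.+1)) ->
  exists s, ~ is_cauchy D (orbit P s (x 0%N)).
Proof.
move=> Pd Wd d0 dsum x1.
pose flat n := flatten (mkseq W n).
have flatS n : flat n.+1 = flat n ++ W n.
  by rewrite /flat /mkseq -[n.+1]addn1 iotaD map_cat flatten_cat /= cats0.
have W0 n : (0 < size (W n))%N.
  rewrite lt0n; apply/eqP => /size0nil Wn; have := Wd n; rewrite Wn /= => h.
  have := le_trans (x1 n) h; apply/negP; rewrite -ltNge.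
  have := dsum n.+1; rewrite big_ord_recr/= => h1.
  have h2 : 0 <= \sum_(i < n) d i by apply: sumr_ge0.
  lra.
have size_flat n : (n <= size (flat n))%N.
  by elim: n => // n IH; rewrite flatS size_cat -addn1 leq_add.
have flat_pre m n : (m <= n)%N -> exists l, flat n = flat m ++ l.
  move=> /subnK <-; elim: (n - m)%N => [|p [l IH]]; first by exists [::]; rewrite cats0.
  by exists (l ++ W (p + m)%N); rewrite addSn flatS IH catA.
pose s i := nth ord0 (flat i) i.-1.
exists s; move=> /(_ (1 / 2)) [|n0 hc]; first by rewrite divr_gt0.
have sE n i : (i < size (flat n))%N -> s i.+1 = nth ord0 (flat n) i.
  move=> hi; rewrite /s /=; case: (leqP i.+1 n) => hin.
    have [l ->] := flat_pre _ _ hin.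
    by rewrite nth_cat (leq_trans _ (size_flat i.+1)).
  by have [l ->] := flat_pre _ _ (ltnW hin); rewrite nth_cat hi.
have err N : nrm (orbit P s (x 0%N) (size (flat N)) - x N) <= \sum_(n < N) d n.
  rewrite orbit_act; last exact: sE.
  elim: N => [|N IH]; first by rewrite subrr nrm0 big_ord0.
  rewrite big_ord_recr/= flatS act_cat.
  apply: le_trans (nrm_dist _ _ (act P (W N) (x N)) _) _; apply: lerD => //.
  exact: le_trans (act_dist _ _ _ Pd) IH.
have e1 := le_trans (err n0) (dsum _); have e2 := le_trans (err n0.+1) (dsum _).
have := hc _ _ (size_flat n0) (leq_trans (leqnSn _) (size_flat n0.+1)).
have := x1 n0.
have := nrm_dist D (x n0) (orbit P s (x 0%N) (size (flat n0))) (x n0.+1).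
have := nrm_dist D (orbit P s (x 0%N) (size (flat n0)))
  (orbit P s (x 0%N) (size (flat n0.+1))) (x n0.+1).
by rewrite nrmB in e1 => *; lra.
Qed.

Variable X : 'I_3 -> set H.
Hypothesis X_csub : forall j, csub D (X j).
Local Notation P := (fun j => proj D (X j)).

Lemma orbitL s a x y n :
  orbit P s (a *: x + y) n = a *: orbit P s x n + orbit P s y n.
Proof. by elim: n => //= n ->; rewrite projL. Qed.

Lemma orbit_dist s x y n : nrm (orbit P s x n - orbit P s y n) <= nrm (x - y).
Proof. by elim: n => //= n IH; apply: le_trans IH; apply: proj_dist. Qed.

Definition stable : set H := [set x | forall s, is_cauchy D (orbit P s x)].

Lemma csub_stable : csub D stable.
Proof.
split.
- move=> s e e0; exists 0%N => m n _ _.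
  have o0 i : orbit P s 0 i = 0 by elim: i => //= i ->; rewrite proj0.
  by rewrite !o0 subrr nrm0.
- move=> a x y hx hy s e e0.
  have a0 : 0 < `|a| + 1 by rewrite ltr_wpDl.
  have [n1 h1] := hx s (e / 2 / (`|a| + 1)) (divr_gt0 (divr_gt0 e0 (ltr0Sn _ _)) a0).
  have [n2 h2] := hy s (e / 2) (divr_gt0 e0 (ltr0Sn _ _)).
  exists (maxn n1 n2) => m n; rewrite !geq_max => /andP[m1 m2] /andP[l1 l2].
  rewrite !orbitL opprD addrACA -scalerBr.
  apply: le_lt_trans (nrmD _ _ _) _; rewrite nrmZ.
  have := h1 m n m1 l1; rewrite ltr_pdivlMr// => h.
  have := h2 m n m2 l2; have := normr_ge0 a.
  have := nrm_ge0 D (orbit P s x m - orbit P s x n).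
  move: h; set p := nrm _; set q := nrm _; set r := `|a| => *; nra.
- move=> u x hu ux s e e0; have e3 : 0 < e / 3 by rewrite divr_gt0.
  have [n0 h0] := ux _ e3; have [n1 h1] := hu n0 s _ e3.
  exists n1 => m n hm hn; have hd := h0 n0 (leqnn _).
  have d1 := le_lt_trans (orbit_dist s (u n0) x m) hd.
  have d2 := le_lt_trans (orbit_dist s (u n0) x n) hd.
  apply: le_lt_trans (nrm_dist _ _ (orbit P s (u n0) m) _) _.
  have := nrm_dist D (orbit P s (u n0) m) (orbit P s (u n0) n) (orbit P s x n).
  have := h1 m n hm hn; rewrite (nrmB D (orbit P s x m)) => *; lra.
Qed.

Lemma stable_inv j x : stable x -> stable (P j x).
Proof.
move=> hx s e e0.
have [n0 h] := hx (fun i => if i is i'.+2 then s i'.+1 else j) e e0.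
exists n0 => m n hm hn; rewrite -!orbit_shift; apply: h; exact: leqW.
Qed.

End Orbits.

(** Used to keep the parameters t of different indices distinct: the exponent of 2
identifies the index. *)
Lemma odd_part_inj s s' m m' :
  (2 ^ s * m.*2.+1 = 2 ^ s' * m'.*2.+1)%N -> s = s'.
Proof.
have h p n : logn 2 (2 ^ p * n.*2.+1) = p.
  rewrite lognM ?expn_gt0// pfactorK// lognE /= dvdn2 /= odd_double /=.
  by rewrite addn0.
by move=> e; rewrite -(h s m) e h.
Qed.

(** * Choice of the parameters along one orthonormal family *)

(** The labels of the vectors e n, z n i and w n i of one chain. *)
Local Notation label k :=
  (nat + ({n & 'I_(k n)} + {n & 'I_(k n)}))%type.

Section Component.
Variables (R : realType) (H : lmodType R) (D : hilbert H).
Local Notation nrm := (nrm D).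
Local Notation proj := (proj D).
Variables (k : nat -> nat) (al be : nat -> nat -> R) (eps : nat -> R).
Hypotheses (circ : forall n j, al n j ^+ 2 + be n j ^+ 2 = 1)
  (al0 : forall n, al n 0%N = 1) (be0 : forall n, be n 0%N = 0)
  (alk : forall n, al n (k n) = 0) (bek : forall n, be n (k n) = 1)
  (k1 : forall n, (1 < k n)%N)
  (al1 : forall n, al n 1%N != 0) (be1 : forall n, be n 1%N != 0)
  (eps0 : forall n, 0 < eps n)
  (eps_sum : forall N, \sum_(n < N) eps n <= 1 / 12)
  (slow : forall n,
    \sum_(j < k n) (1 - (al n j * al n j.+1 + be n j * be n j.+1)) <= eps n).

Variable f : label k -> H.
Hypothesis f_on : forall l l', D (f l) (f l') = (l == l')%:R.

Let e n : H := f (inl n).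
Let z n (i : 'I_(k n)) : H := f (inr (inl (Tagged _ i))).
Let w n (i : 'I_(k n)) : H := f (inr (inr (Tagged _ i))).
Arguments z : clear implicits.
Arguments w : clear implicits.

Let ee m n : D (e m) (e n) = (m == n)%:R. Proof. by rewrite f_on. Qed.
Let zz n i j : D (z n i) (z n j) = (i == j)%:R.
Proof.
transitivity ((Tagged (fun n => 'I_(k n)) i == Tagged _ j)%:R : R).
  by rewrite f_on.
by rewrite eq_Tagged.
Qed.
Let ww n i j : D (w n i) (w n j) = (i == j)%:R.
Proof.
transitivity ((Tagged (fun n => 'I_(k n)) i == Tagged _ j)%:R : R).
  by rewrite f_on.
by rewrite eq_Tagged.
Qed.
Let zz0 m n i j : m != n -> D (z m i) (z n j) = 0.
Proof.
move=> mn; rewrite f_on; case: eqP => // h; case/eqP: mn.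
exact: (congr1 (fun l => if l is inr (inl u) then tag u else 0%N) h).
Qed.
Let ww0 m n i j : m != n -> D (w m i) (w n j) = 0.
Proof.
move=> mn; rewrite f_on; case: eqP => // h; case/eqP: mn.
exact: (congr1 (fun l => if l is inr (inr u) then tag u else 0%N) h).
Qed.
Let ez m n i : D (e m) (z n i) = 0. Proof. by rewrite f_on. Qed.
Let ew m n i : D (e m) (w n i) = 0. Proof. by rewrite f_on. Qed.
Let zw m n i j : D (z m i) (w n j) = 0. Proof. by rewrite f_on. Qed.

Let a n (i : 'I_(k n)) := al n i.+1.
Let c n (i : 'I_(k n)) := - be n i.+1.

(** The admissible values of t n i, indexed by m: they accumulate at 0, and the
values of different pairs (n, i) differ. *)
Let code (n i m : nat) : R := (2 ^ pickle (n, i) * m.*2.+1)%N%:R^-1.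

Let code_inj n i m n' i' m' : code n i m = code n' i' m' -> n = n' /\ i = i'.
Proof.
move=> /invr_inj /eqP; rewrite eqr_nat => /eqP /odd_part_inj /(pcan_inj pickleK).
by case.
Qed.

Let code_small n i r : 0 < r -> exists2 x, range (code n i) x & 0 < x < r.
Proof.
move=> r0; pose m := Num.Def.truncn r^-1.
exists (code n i m); first by exists m.
have c0 : (0 < 2 ^ pickle (n, i) * m.*2.+1)%N by rewrite muln_gt0 expn_gt0.
rewrite /code invr_gt0 ltr0n c0 /= invf_plt ?posrE ?ltr0n//.
apply: lt_le_trans (truncnS_gt _) _; rewrite ler_nat.
rewrite -/m -[X in (X <= _)%N]mul1n leq_mul ?expn_gt0// ltnS.
by rewrite -addnn leq_addr.
Qed.

Let idl (b t : nat -> nat -> R) n :=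
  ideal D (e n) (e n.+1) (z n) (w n) (al n) (be n) (b n) (t n).
Let fin (t : nat -> nat -> R) n (i : 'I_(k n)) := t n i.

(** A block m next to block n has n = m - 1 or n = m + 1, so its parameters obey
one of the two bounds. *)
Lemma drift_le (t : nat -> nat -> R) (K : nat -> nat) n :
  (forall m (i : 'I_(k m)), (m == n.+1) || (m.+1 == n) -> t m i <=
    Num.min (eps m.-1 / (4 * (K m.-1).+1%:R)) (eps m.+1 / (4 * (K m.+1).+1%:R))
      / (k m).+1%:R) ->
  drift (fin t) n <= eps n / (K n).+1%:R.
Proof.
move=> ht; set x := eps n / _; have x0 : 0 <= x by apply/ltW/divr_gt0.
rewrite /drift; apply: (@le_trans _ _ (2 * \sum_(m < n.+2 | (m == n.+1 :> nat) ||
  (m.+1 == n :> nat)) x / 4)).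
  apply: ler_wpM2l => //; apply: ler_sum => m nm.
  apply: (@le_trans _ _ (\sum_(i < k m) (x / 4 / (k m).+1%:R))).
    apply: ler_sum => i _; apply: le_trans (ht m i nm) _.
    apply: ler_wpM2r; first by rewrite invr_ge0.
    have xE : eps n / (4 * (K n).+1%:R) = x / 4.
      by rewrite /x invfM mulrA mulrAC.
    case/orP: nm => /eqP nm.
      have -> : (m : nat).-1 = n by rewrite nm.
      by rewrite xE ge_min lexx.
    by rewrite nm xE ge_min lexx orbT.
  rewrite sumr_const card_ord -[X in X <= _]mulr_natl mulrCA.
  apply: ler_piMr; first by apply: divr_ge0.
  by rewrite ler_pdivrMr// mul1r ler_nat.
rewrite sumr_const -[X in _ * X]mulr_natl.
have : (#|[pred m : 'I_n.+2 | (m == n.+1 :> nat) || (m.+1 == n :> nat)]| <= 2)%N.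
  apply: leq_trans (_ : #|pred2 (inord n.+1 : 'I_n.+2) (inord n.-1)| <= 2)%N.
    apply: subset_leq_card; apply/fintype.subsetP => m; rewrite !inE.
    move=> /orP[/eqP h|/eqP h]; apply/orP; [left|right]; apply/eqP/val_inj => /=.
      by rewrite inordK.
    rewrite inordK; first exact: (congr1 predn h).
    by rewrite ltnS (leq_trans (leq_pred _)).
  by rewrite card2; case: (_ == _).
rewrite -(ler_nat R) => h.
have x4 : 0 <= x / 4 by rewrite divr_ge0.
have := ler_wpM2r x4 h; move: (_ * (x / 4)) => y; lra.
Qed.

(** The order of the choices: the b and the numbers C of letters X for all blocks,
then t and the words for the odd blocks, then t and the words for the even
blocks. *)
Lemma turning_parameters : exists b t : nat -> nat -> R, exists word : nat -> seq role,
  [/\ forall n i, 0 < b n i <= 1,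
      forall n i, (i < k n)%N -> 0 < t n i /\ range (code n i) (t n i),
      forall n, nrm (act (fun r => proj (idl b t n r)) (word n) (e n) - e n.+1) <= 2 * eps n &
      forall n, \sum_(r <- word n) cost (fin t) n r <= eps n].
Proof.
have e1 n : D (e n) (e n) = 1 by rewrite ee eqxx.
have e2 n : D (e n) (e n.+1) = 0 by rewrite ee ltn_eqF.
have ze m n i : D (z n i) (e m) = 0 by rewrite dotC.
have we m n i : D (w n i) (e m) = 0 by rewrite dotC.
have qt n : exists bC : (nat -> R) * nat, (forall i, 0 < bC.1 i <= 1) /\
  forall rho : R, 0 < rho -> exists t : nat -> R, exists word : seq role,
    [/\ forall i, (i < k n)%N -> range (code n i) (t i) /\ 0 < t i < rho,
        (count isX word <= bC.2)%N &
        nrm (act (fun a => proj (ideal D (e n) (e n.+1) (z n) (w n) (al n) (be n)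
          bC.1 t a)) word (e n) - e n.+1) <= 2 * eps n].
  have [b [C [b1 h]]] := quarter_turn (e1 n) (e1 n.+1) (e2 n) (@zz n) (@ww n) (@zw n n)
    (ze n n) (ze n.+1 n) (we n n) (we n.+1 n) (circ n) (al0 n) (be0 n) (alk n) (bek n)
    (eps0 n) (slow n).
  exists (b, C); split=> // rho rho0.
  apply: (h (fun i => range (code n i)) rho rho0) => i r; exact: code_small.
have /choice[bC hbC] := qt.
pose b n := (bC n).1; pose C n := (bC n).2.
have /choice[g hg] : forall nr : nat * R, exists tw : (nat -> R) * seq role, 0 < nr.2 ->
    [/\ forall i, (i < k nr.1)%N -> range (code nr.1 i) (tw.1 i) /\ 0 < tw.1 i < nr.2,
        (count isX tw.2 <= C nr.1)%N &
        nrm (act (fun a => proj (ideal D (e nr.1) (e nr.1.+1) (z nr.1) (w nr.1)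
          (al nr.1) (be nr.1) (b nr.1) tw.1 a)) tw.2 (e nr.1) - e nr.1.+1) <= 2 * eps nr.1].
  move=> [n r] /=; have [r0|r0] := ltP 0 r; last first.
    by exists (fun=> 0, [::]).
  by have [t [word h]] := (hbC n).2 r r0; exists (t, word).
(* K m is the number of disturbed letters in the word of block m; each of the at
   most two neighbours of a block may use half of its tolerance. *)
pose bound (K : nat -> nat) m := Num.min (eps m.-1 / (4 * (K m.-1).+1%:R))
  (eps m.+1 / (4 * (K m.+1).+1%:R)) / (k m).+1%:R.
have bound0 K m : 0 < bound K m.
  by rewrite divr_gt0// lt_min !divr_gt0// mulr_gt0.
pose rhoA := bound C; pose B n := size (g (n, rhoA n)).2.
pose rhoB := bound B.
pose rho n := if odd n then rhoA n else rhoB n.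
have rho0 n : 0 < rho n by rewrite /rho; case: odd; apply: bound0.
pose t n := (g (n, rho n)).1; pose word n := (g (n, rho n)).2.
have gE n : [/\ forall i, (i < k n)%N -> range (code n i) (t n i) /\ 0 < t n i < rho n,
        (count isX (word n) <= C n)%N &
        nrm (act (fun a => proj (ideal D (e n) (e n.+1) (z n) (w n)
          (al n) (be n) (b n) (t n) a)) (word n) (e n) - e n.+1) <= 2 * eps n].
  by have /= := hg (n, rho n) (rho0 n).
exists b, t, word; split.
- by move=> n i; have [h _] := hbC n; apply: h.
- by move=> n i ik; have [h _ _] := gE n; have [? /andP[]] := h i ik.
- by move=> n; have [] := gE n.
move=> n; have [_ hC _] := gE n.
have small m (i : 'I_(k m)) : t m i <= rho m.
  by have [h _ _] := gE m; have [_ /andP[_ /ltW]] := h i (ltn_ord i).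
have drift0 : 0 <= drift (fin t) n.
  apply: mulr_ge0 => //; apply: sumr_ge0 => m _; apply: sumr_ge0 => i _.
  by have [h _ _] := gE m; have [_ /andP[/ltW]] := h i (ltn_ord i).
have odd_nbr m : (m == n.+1) || (m.+1 == n) -> odd m = ~~ odd n.
  by case/orP => /eqP; [move=> ->|move=> <- /=; rewrite negbK].
case on : (odd n).
  have hd : drift (fin t) n <= eps n / (B n).+1%:R.
    apply: drift_le => m i nm; apply: le_trans (small m i) _.
    by rewrite /rho (odd_nbr _ nm) on.
  apply: (@le_trans _ _ (\sum_(r <- word n) drift (fin t) n)).
    by apply: ler_sum => r _; rewrite /cost; case: role_of.
  rewrite big_const_seq count_predT iter_addr addr0.
  have -> : size (word n) = B n by rewrite /word /B /rho on.
  rewrite -[X in X <= _]mulr_natl; apply: le_trans (ler_wpM2l (ler0n _ _) hd) _.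
  rewrite mulrCA; apply: ler_piMr; first exact: ltW.
  by rewrite ler_pdivrMr// mul1r ler_nat.
have hd : drift (fin t) n <= eps n / (C n).+1%:R.
  apply: drift_le => m i nm; apply: le_trans (small m i) _.
  by rewrite /rho (odd_nbr _ nm) on.
have -> : \sum_(r <- word n) cost (fin t) n r = \sum_(r <- word n | isX r) drift (fin t) n.
  rewrite [RHS]big_mkcond; apply: eq_bigr => r _.
  by rewrite /cost on; case: r; rewrite /role_of /= inordK.
rewrite big_const_seq iter_addr addr0.
rewrite -[X in X <= _]mulr_natl; apply: le_trans (ler_wpM2l (ler0n _ _) hd) _.
rewrite mulrCA; apply: ler_piMr; first exact: ltW.
by rewrite ler_pdivrMr// mul1r ler_nat (leq_trans hC).
Qed.

Let basisE : basis e z w = range f.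
Proof.
apply/seteqP; split=> x.
  move=> [[n ->]|[[n [i ->]]|[n [i ->]]]].
  - by exists (inl n).
  - by exists (inr (inl (Tagged (fun n => 'I_(k n)) i))).
  - by exists (inr (inr (Tagged (fun n => 'I_(k n)) i))).
move=> [[n|[[n i]|[n i]]] _ <-].
- by left; exists n.
- by right; left; exists n, i.
- by right; right; exists n, i.
Qed.

Let ac1 n i : @a n i ^+ 2 + @c n i ^+ 2 = 1.
Proof. by rewrite /a /c sqrrN circ. Qed.

Let gvecE n (i : 'I_(k n)) :
  gvec e a c i = normal (e n) (e n.+1) (al n) (be n) i.
Proof. by rewrite /gvec /normal /a /c scaleNr. Qed.

Let idlP b t n r x : idl b t n r x <->
  block D (e n) (e n.+1) (z n) (w n) x /\ forall i, match r with
  | rX => D x (z n i) = 0 /\ D x (w n i) = 0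
  | rS => D x (w n i) = 0
  | rY => D x (ycons e z w a c (fin b) (fin t) i) = 0 end.
Proof.
rewrite /idl; case: r => /=.
- split=> [/spaceXP[/spaceSP[Bx xw] xz]|[Bx h]]; first by split.
  apply/spaceXP; split=> [|i]; last by have [] := h i.
  by apply/spaceSP; split=> // i; have [] := h i.
- exact: spaceSP.
- split=> [/spaceYP[Bx h]|[Bx h]]; [|apply/spaceYP]; split=> // i.
    rewrite dot_ycons h /qvec -gvecE dotBr dotZr /fin; ring.
  have := h i; rewrite dot_ycons /qvec -gvecE dotBr dotZr /fin => /eqP.
  by rewrite subr_eq0 => /eqP.
Qed.

(** The subspaces X j are only prescribed on the closed span of f, which therefore
reduces the three projections. *)
Theorem stable_perp_family : exists F : 'I_3 -> set H,
  (forall j, F j `<=` cspan D (range f)) /\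
  forall X : 'I_3 -> set H, (forall j, csub D (X j)) ->
    (forall j, X j `<=` perp D (F j)) ->
    (forall j, cspan D (range f) `&` perp D (F j) `<=` X j) ->
    forall x y, stable D X x -> cspan D (range f) y -> D x y = 0.
Proof.
have [b [t [word [b01 t0 hword hcost]]]] := turning_parameters.
pose F := constraints e z w a c (fin b) (fin t).
rewrite -basisE; set B := cspan D (basis e z w).
have cB : csub D B by apply: csub_cspan.
have Be n : B (e n) by apply: span_e.
have Bz n i : B (z n i) by apply: span_z.
have Bw n i : B (w n i) by apply: span_w.
have B_yc n i : B (ycons e z w a c (fin b) (fin t) i).
  apply: (csubB cB) => //; apply: (csubZ _ cB); apply: (csubB cB) => //.
  by apply: (csubZ _ cB); exact: span_g.
have FB j : F j `<=` B.
  move=> x [n [i ]]; case: role_of => [[->|->]|->|->];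
    [exact: Bz|exact: Bw|exact: Bw|exact: B_yc].
exists F; split=> // X Xc XF FX x y sx By.
have t0' n (i : 'I_(k n)) : 0 < fin t i by have [] := t0 n i (ltn_ord i).
have t_inj n m (i : 'I_(k n)) (j : 'I_(k m)) :
    fin t i = fin t j -> n = m /\ (i = j :> nat).
  have [_ [p _ hp]] := t0 n i (ltn_ord i); have [_ [p' _ hp']] := t0 m j (ltn_ord j).
  by rewrite /fin -hp -hp'; apply: code_inj.
have b0 n (i : 'I_(k n)) : fin b i != 0 by have /andP[/gt_eqF/negbT] := b01 n i.
have b1 n (i : 'I_(k n)) : `|fin b i| <= 1.
  by have /andP[h1 h2] := b01 n i; rewrite ger0_norm// ltW.
have e1 n : nrm (e n) = 1 by apply: nrm1; rewrite ee eqxx.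
have e0_unstable : ~ stable D X (e 0%N).
  pose W n := [seq player (odd n) r | r <- word n].
  have actW n v : act (fun j => proj (X j)) (W n) v =
      act (fun r => proj (X (player (odd n) r))) (word n) v.
    by rewrite /W /act; elim: (word n) v => //= r l IH v; rewrite IH.
  have h n : nrm (act (fun j => proj (X j)) (W n) (e n) - e n.+1) <= 3 * eps n.
    rewrite actW; apply: le_trans (nrm_dist _ _
      (act (fun r => proj (idl b t n r)) (word n) (e n)) _) _.
    have -> : 3 * eps n = eps n + 2 * eps n by ring.
    apply: lerD; last exact: hword.
    have := act_near (D := D) (P := fun r => proj (X (player (odd n) r)))
      (Q := fun r => proj (idl b t n r)) (B := block D (e n) (e n.+1) (z n) (w n))
      (g := cost (fin t) n) (word n) (x := e n).
    rewrite e1 mulr1 => h; apply: le_trans (hcost n); apply: h.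
    - by move=> r v v'; apply: proj_dist.
    - by move=> r v _; have /idlP[] : idl b t n r (proj (idl b t n r) v)
        by apply: projM; apply: csub_ideal.
    - by move=> r v; apply: proj_le; apply: csub_ideal.
    - move=> r; rewrite /cost; case: role_of => //.
      apply: mulr_ge0 => //; apply: sumr_ge0 => m _; apply: sumr_ge0 => i _; exact/ltW/t0'.
    - move=> r v Bv.
      apply: (proj_near_ideal ee zz ww zz0 ww0 ez ew zw Xc XF FX t0' b1 ac1) Bv.
        by move=> r'; apply: csub_ideal.
      by move=> r' v'; exact: idlP.
    - exact: block_u.
  have [||||s hs] := orbit_not_cauchy (D := D) (x := e) (P := fun j => proj (X j)) _ h.
  - by move=> j v v'; apply: proj_dist.
  - by move=> n; apply: mulr_ge0 => //; exact: ltW.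
  - by move=> N; rewrite -mulr_sumr; have := eps_sum N; move: (\sum_(_ < _) _) => S; lra.
  - move=> n; have -> : 1 = nrm (e n) by rewrite e1.
    rewrite -(ler_pXn2r (n := 2)) ?nnegrE ?nrm_ge0// !nrm_sqr !dotE !ee !eqxx.
    by rewrite ltn_eqF// gtn_eqF//=; lra.
  by move=> /(_ s).
pose E := proj B.
have EX j v : X j v -> X j (E v).
  move=> Xv; apply: FX; split; first exact: projM.
  by move=> u Fu; rewrite /E proj_dot//; [exact: XF Xv _ Fu|exact: FB Fu].
(* The projections commute with E, so it suffices to treat the component of x in
   the closed span of f. *)
have Ecomm j v : proj (X j) (E v) = E (proj (X j) v).
  apply: proj_eq => //; first by apply: EX; apply: projM.
  move=> u Xu; rewrite /E -projB// proj_sym// proj_perp//.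
  exact: EX.
have Eorbit s n : orbit (fun j => proj (X j)) s (E x) n = E (orbit (fun j => proj (X j)) s x n).
  by elim: n => //= n ->; rewrite Ecomm.
have sE : stable D X (E x).
  move=> s ep ep0; have [n0 hn] := sx s _ ep0; exists n0 => m n hm hm'.
  by rewrite !Eorbit; apply: le_lt_trans (hn _ _ hm hm'); apply: proj_dist.
have E0 : E x = 0.
  apply: (invariant_trivial ee zz ww zz0 ww0 ez ew zw Xc XF FX t0' b0 t_inj ac1 _ _
    (M := stable D X `&` B)).
  - move=> n; have k0 : (0 < k n)%N by apply: ltn_trans (k1 n).
    by exists (Ordinal k0); rewrite /a /c oppr_eq0.
  - move=> n; have kn : ((k n).-1 < k n)%N by rewrite prednK// (ltn_trans _ (k1 n)).
    by exists (Ordinal kn); rewrite /a /= prednK ?alk// (ltn_trans _ (k1 n)).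
  - by apply: csubI => //; apply: csub_stable.
  - by move=> v [].
  - move=> j v [sv Bv]; split; first exact: stable_inv.
    by rewrite -(proj_id cB Bv) -/(E v) Ecomm; apply: projM.
  - by move=> [].
  - by split=> //; apply: projM.
by rewrite -(proj_dot x cB By) -/(E x) E0 dot0l.
Qed.

End Component.

(** The tolerances are summable with three times their sum at most 1/4: a turn in
block n has error at most 2 eps from the ideal block and eps from its
neighbours. *)
Lemma slow_paths (R : realType) :
  exists (k : nat -> nat) (al be : nat -> nat -> R) (eps : nat -> R),
  [/\ [/\ forall n j, al n j ^+ 2 + be n j ^+ 2 = 1, forall n, al n 0%N = 1,
          forall n, be n 0%N = 0, forall n, al n (k n) = 0 & forall n, be n (k n) = 1],
      [/\ forall n, (1 < k n)%N, forall n, al n 1%N != 0 & forall n, be n 1%N != 0],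
      forall n, 0 < eps n,
      forall N, \sum_(n < N) eps n <= 1 / 12 &
      forall n, \sum_(j < k n) (1 - (al n j * al n j.+1 + be n j * be n j.+1)) <= eps n].
Proof.
pose eps n : R := 12^-1 * 2^-1 ^+ n.+1.
have eps0 n : 0 < eps n by rewrite mulr_gt0 ?exprn_gt0 ?invr_gt0.
have /choice[f hf] : forall n, exists f : nat * ((nat -> R) * (nat -> R)),
    [/\ forall j, f.2.1 j ^+ 2 + f.2.2 j ^+ 2 = 1,
      [/\ f.2.1 0%N = 1, f.2.2 0%N = 0, f.2.1 f.1 = 0 & f.2.2 f.1 = 1],
      [/\ (1 < f.1)%N, f.2.1 1%N != 0 & f.2.2 1%N != 0] &
      \sum_(j < f.1) (1 - (f.2.1 j * f.2.1 j.+1 + f.2.2 j * f.2.2 j.+1)) <= eps n].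
  by move=> n; have [k [al [be h]]] := slow_path (eps0 n); exists (k, (al, be)).
exists (fun n => (f n).1), (fun n => (f n).2.1), (fun n => (f n).2.2), eps.
split=> //.
- by split=> n; have [h1 [h2 h3 h4 h5] _ _] := hf n.
- by split=> n; have [_ _ [h1 h2 h3] _] := hf n.
- move=> N; rewrite -mulr_sumr.
  have -> : \sum_(n < N) 2^-1 ^+ n.+1 = 1 - 2^-1 ^+ N :> R.
    elim: N => [|N IH]; first by rewrite big_ord0 expr0 subrr.
    by rewrite big_ord_recr/= IH exprS; set x := _ ^+ N; field.
  have : 0 <= 2^-1 ^+ N :> R by rewrite exprn_ge0 ?invr_ge0.
  by move: (_ ^+ N) => x x0; lra.
- by move=> n; have [_ _ _ h] := hf n.
Qed.

(** * From real to complex scalars, and from one family to the whole space *)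

(** The space H with its scalars restricted along iota. *)
Definition realify (R : realType) (K : numFieldType) (iota : {rmorphism R -> K})
  (H : lmodType K) : Type := H.

Section Realify.
Variables (R : realType) (K : numFieldType) (iota : {rmorphism R -> K}) (H : lmodType K).
HB.instance Definition _ := GRing.Zmodule.on (realify iota H).
Definition rscale (r : R) (x : realify iota H) : realify iota H := iota r *: (x : H).
Fact rscaleA a b v : rscale a (rscale b v) = rscale (a * b) v.
Proof. by rewrite /rscale scalerA rmorphM. Qed.
Fact rscale1 : left_id 1 rscale.
Proof. by move=> v; rewrite /rscale rmorph1 scale1r. Qed.
Fact rscaleDr : right_distributive rscale +%R.
Proof. by move=> a u v; rewrite /rscale scalerDr. Qed.
Fact rscaleDl v : {morph rscale^~ v : a b / a + b}.
Proof. by move=> a b; rewrite /rscale rmorphD scalerDl. Qed.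
HB.instance Definition _ := GRing.Zmodule_isLmodule.Build R (realify iota H)
  rscaleA rscale1 rscaleDr rscaleDl.
End Realify.

Section Glue.
Variables (R : realType) (K : numFieldType) (iota : {rmorphism R -> K}) (re : K -> R)
  (theta : {rmorphism K -> K}).
Hypotheses (reD : forall x y, re (x + y) = re x + re y)
  (reZ : forall r x, re (iota r * x) = r * re x)
  (re1 : re 1 = 1)
  (re_theta : forall x, re (theta x) = re x)
  (theta_iota : forall r, theta (iota r) = iota r)
  (theta_norm : forall x, theta x * x = `|x| ^+ 2)
  (iotaK : forall x, 0 <= x -> iota (re x) = x)
  (iota_le : {mono iota : r s / r <= s}).
Variables (H : completeNormedModType K) (ip : {dot H for theta}).
Hypothesis ipN : induces_norm ip.

Let re_iota r : re (iota r) = r.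
Proof. by rewrite -[iota r]mulr1 reZ re1 mulr1. Qed.
Let re0 : re 0 = 0. Proof. by rewrite -(rmorph0 iota) re_iota. Qed.
Let iota_lt : {mono iota : r s / r < s}.
Proof. exact: leW_mono. Qed.

Let ipC x y : ip x y = theta (ip y x).
Proof. by rewrite (hermC (eps := false)) expr0 mul1r. Qed.
Let ipDl x y z : ip (x + y) z = ip x z + ip y z.
Proof. exact: linearDl. Qed.
Let ipZl a x y : ip (a *: x) y = a * ip x y.
Proof. exact: linearZl_LR. Qed.
Let ipBl x y z : ip (x - y) z = ip x z - ip y z.
Proof. by rewrite ipDl -scaleN1r ipZl mulN1r. Qed.
Let ipZr a x y : ip x (a *: y) = theta a * ip x y.
Proof. by rewrite ipC ipZl rmorphM -ipC. Qed.

Let re_ge0 x : 0 <= x -> 0 <= re x.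
Proof. by move=> x0; rewrite -iota_le rmorph0 iotaK. Qed.

(** Testing with a = <x, y> turns the real part into |<x, y>|^2. *)
Let nondeg x y : (forall a, re (ip x (a *: y)) = 0) -> ip x y = 0.
Proof.
move=> h; have := h (ip x y); rewrite ipZr theta_norm => h0.
have : iota (re (`|ip x y| ^+ 2)) = `|ip x y| ^+ 2 by rewrite iotaK// exprn_ge0.
by rewrite h0 rmorph0 => /esym/eqP; rewrite expf_eq0/= normr_eq0 => /eqP.
Qed.

Let RH := realify iota H.
Let rdot (x y : RH) : R := re (ip x y).

Let norm_iota x : `|x| = iota (Num.sqrt (rdot x x)).
Proof.
have xx0 : 0 <= ip x x by rewrite ipN exprn_ge0.
have s0 : 0 <= iota (Num.sqrt (rdot x x)) by rewrite -(rmorph0 iota) iota_le sqrtr_ge0.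
apply/eqP; rewrite -(eqrXn2 (n := 2))//; apply/eqP.
by rewrite -rmorphXn/= sqr_sqrtr ?re_ge0// iotaK// ipN.
Qed.

Let rdotC x y : rdot x y = rdot y x.
Proof. by rewrite /rdot ipC re_theta. Qed.
Let rdotDl x y z : rdot (x + y) z = rdot x z + rdot y z.
Proof. by rewrite /rdot ipDl reD. Qed.
Let rdotZl a x y : rdot (a *: x) y = a * rdot x y.
Proof. by rewrite /rdot ipZl reZ. Qed.
Let rdot_ge0 x : 0 <= rdot x x.
Proof. by apply: re_ge0; rewrite ipN exprn_ge0. Qed.
Let rdot_eq0 x : rdot x x = 0 -> x = 0.
Proof.
move=> h; have := norm_iota x; rewrite h sqrtr0 rmorph0 => /eqP.
by rewrite normr_eq0 => /eqP.
Qed.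

Let pos_iota (e : K) : 0 < e -> exists2 r, 0 < r & e = iota r.
Proof.
move=> e0; exists (re e); last by rewrite iotaK// ltW.
by rewrite -iota_lt rmorph0 iotaK// ltW.
Qed.

Let rdot_complete (u : nat -> RH) :
  (forall e : R, 0 < e -> exists n0, forall m n, (n0 <= m)%N -> (n0 <= n)%N ->
     Num.sqrt (rdot (u m - u n) (u m - u n)) < e) ->
  exists x, forall e : R, 0 < e -> exists n0, forall n, (n0 <= n)%N ->
     Num.sqrt (rdot (u n - x) (u n - x)) < e.
Proof.
move=> hu; have : cvgn (u : nat -> H).
  apply/cauchy_cvgP/cauchyP => e /pos_iota[r r0 ->].
  have [n0 h] := hu r r0; exists (u n0); exists n0 => // n /= hn.
  by rewrite -ball_normE /= norm_iota iota_lt h.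
move=> /cvg_ex[l /cvgrPdist_lt hl]; exists l => e e0.
have [|n0 _ h] := hl (iota e); first by rewrite -(rmorph0 iota) iota_lt.
by exists n0 => n /h; rewrite distrC norm_iota iota_lt.
Qed.

Definition realHilbert : hilbert RH :=
  Hilbert rdotC rdotDl rdotZl rdot_ge0 rdot_eq0 rdot_complete.
Local Notation D := realHilbert.

Let cvgn_is_cauchy (u : nat -> H) : cvgn u -> is_cauchy D u.
Proof.
move=> /cvg_ex[l /cvgrPdist_lt hl]; apply: (@tends_is_cauchy _ _ D u l) => e e0.
have [|n0 _ h] := hl (iota e); first by rewrite -(rmorph0 iota) iota_lt.
by exists n0 => n /h; rewrite distrC norm_iota iota_lt.
Qed.

(** Orthogonality with respect to the scalar field K. *)
Definition kperp (C : set H) : set H := [set x | forall c, C c -> ip x c = 0].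

Lemma kperp_closed C : closed_subspace (kperp C).
Proof.
split.
  split; first by rewrite inE => c _; rewrite -(scale0r 0) ipZl mul0r.
  by move=> a x y; rewrite !inE => hx hy c Cc; rewrite ipDl ipZl hx// hy// mulr0 addr0.
move=> x hx c Cc; apply: nondeg => a.
apply/eqP; rewrite -normr_eq0; apply/eqP/le_anti; rewrite normr_ge0 andbT.
apply/ler_addgt0Pr => e e0; rewrite add0r.
pose s := nrm D (a *: c : RH); have s0 : 0 <= s by apply: nrm_ge0.
have s1 : 0 < s + 1 by rewrite ltr_wpDl.
have es : 0 < e / (s + 1) by rewrite divr_gt0.
have [|y [hy]] := hx (ball x (iota (e / (s + 1)))).
  by apply: nbhsx_ballx; rewrite -(rmorph0 iota) iota_lt.
rewrite -ball_normE /= norm_iota iota_lt => hxy.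
have -> : re (ip x (a *: c)) = D (x - y : RH) (a *: c : RH).
  by rewrite /= /rdot ipBl [ip y _]ipZr hy// mulr0 subr0.
apply: le_trans (cauchy_schwarz _ _ _) _; rewrite -/s.
have := hxy; rewrite -[Num.sqrt _]/(nrm D (x - y : RH)) ltr_pdivlMr// => h1.
have := nrm_ge0 D (x - y : RH) => h2; nra.
Qed.

Section Proj.
Variable C : set H.
Let X := kperp C.

(** As a real subspace, a K-orthogonal complement is the real orthogonal complement
of all K-multiples. *)
Lemma csub_kperp : csub D X.
Proof.
have -> : X = perp D [set x : RH | exists a c, C c /\ x = a *: (c : H)].
  apply/seteqP; split=> x hx.
    by move=> _ [a [c [Cc ->]]]; rewrite /= /rdot ipZr hx// mulr0.
  by move=> c Cc; apply: nondeg => a; apply: hx; exists a, c.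
exact: csub_perp.
Qed.

Let XZ a x : X x -> X (a *: x).
Proof. by move=> hx c Cc; rewrite ipZl hx// mulr0. Qed.

Lemma proj_kperp x y : X y -> ip (x - proj D X x) y = 0.
Proof.
by move=> Xy; apply: nondeg => a; apply: (proj_perp x csub_kperp (XZ a Xy)).
Qed.

Lemma orth_projE x : orth_proj ip X x = proj D X x.
Proof.
apply: esym; apply: (proj_eq csub_kperp).
  rewrite /orth_proj; case: xgetP => [p _ []//|h].
  by case: (h (proj D X x)); split; [exact: projM csub_kperp|exact: proj_kperp].
move=> y Xy; rewrite /orth_proj; case: xgetP => [p _ [_ h]|h].
  by rewrite /= /rdot h.
by case: (h (proj D X x)); split; [exact: projM csub_kperp|exact: proj_kperp].
Qed.

Lemma proj_kperpZ a x : proj D X (a *: (x : H)) = a *: (proj D X x : H).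
Proof.
apply: (proj_eq csub_kperp); first by apply: XZ; exact: projM csub_kperp.
move=> y Xy; change (re (ip ((a *: x : H) - (a *: (proj D X x : H) : H)) y) = 0).
by rewrite -scalerBr ipZl proj_kperp// mulr0.
Qed.

End Proj.

Lemma iterates_orbit (C : 'I_3 -> set H) s x n :
  iterates ip (fun j => kperp (C j)) s x n =
  orbit (fun j => proj D (kperp (C j))) s x n.
Proof. by elim: n => //= n ->; rewrite orth_projE. Qed.

Lemma iteratesZ (C : 'I_3 -> set H) s a x n :
  iterates ip (fun j => kperp (C j)) s (a *: x) n =
  a *: iterates ip (fun j => kperp (C j)) s x n.
Proof. by elim: n => //= n ->; rewrite !orth_projE proj_kperpZ. Qed.

Section Families.
Variable k : nat -> nat.
Let T := label k.
Implicit Types (Phi : set (T -> H)).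

Definition orthofam Phi := (forall f, Phi f -> forall s t, ip (f s) (f t) = (s == t)%:R) /\
  (forall f g, Phi f -> Phi g -> f <> g -> forall s t, ip (f s) (g t) = 0).

Definition famperp Phi : set H := [set x | forall f, Phi f -> forall t, ip x (f t) = 0].

Let ip0_sym x y : ip x y = 0 -> ip y x = 0.
Proof. by move=> h; rewrite ipC h rmorph0. Qed.

(** An orthonormal sequence orthogonal to a maximal set of families could be
relabelled and added to it. *)
Lemma maximal_orthofam : exists Phi, orthofam Phi /\
  forall h : nat -> H, (forall i j, ip (h i) (h j) = (i == j)%:R) ->
    ~ (forall i, famperp Phi (h i)).
Proof.
have [F FP Ftot|Phi [oPhi maxPhi]] := @Zorn_bigcup _ orthofam.
  split=> [f [A FA Af]|f g [A FA Af] [B FB Bg] fg]; first exact: (FP _ FA).1.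
  by case: (Ftot _ _ FA FB) => AB; [apply: (FP _ FB).2|apply: (FP _ FA).2] => //; exact: AB.
exists Phi; split=> // h h_on h_perp; pose f t := h (pickle (t : T)).
have f_on s t : ip (f s) (f t) = (s == t)%:R.
  by rewrite h_on (inj_eq (pcan_inj pickleK)).
have nPhi : ~ Phi f.
  move=> Phif; have := h_perp (pickle (inl 0%N : T)) f Phif (inl 0%N).
  by rewrite -[X in ip X]/(f _) f_on eqxx => /eqP; rewrite oner_eq0.
apply: (maxPhi (Phi `|` [set f])).
  by split=> [|sub]; [left|apply: nPhi; apply: sub; right].
split=> [g [/oPhi.1//|->//]|g g' [Pg|->] [Pg'|->] // gg' s t].
- exact: oPhi.2.
- exact/ip0_sym/h_perp.
- exact: h_perp.
Qed.

(** Otherwise every finite orthonormal sequence orthogonal to Phi can be extended,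
and iterating this yields an infinite one. *)
Lemma complete_orthofam Phi :
  (forall h : nat -> H, (forall i j, ip (h i) (h j) = (i == j)%:R) ->
    ~ (forall i, famperp Phi (h i))) ->
  exists a : seq H,
  [/\ forall i j, (i < size a)%N -> (j < size a)%N -> ip a`_i a`_j = (i == j)%:R,
      forall i, (i < size a)%N -> famperp Phi a`_i &
      forall x, famperp Phi x -> (forall i, (i < size a)%N -> ip x a`_i = 0) -> x = 0].
Proof.
move=> maxPhi; apply: contrapT => none.
pose good (a : seq H) :=
  (forall i j, (i < size a)%N -> (j < size a)%N -> ip a`_i a`_j = (i == j)%:R) /\
  (forall i, (i < size a)%N -> famperp Phi a`_i).
have /choice[nxt hnxt] : forall a : seq H, exists y, good a ->
    [/\ ip y y = 1, famperp Phi y & forall i, (i < size a)%N -> ip y a`_i = 0].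
  move=> a; have [[g1 g2]|] := pselect (good a); last by exists 0.
  have [x [x0 xP xa]] : exists x, [/\ x <> 0, famperp Phi x &
      forall i, (i < size a)%N -> ip x a`_i = 0].
    apply: contrapT => nox; apply: none; exists a; split=> // x xP xa.
    by apply: contrapT => x0; apply: nox; exists x.
  have nx : `|x| != 0 by rewrite normr_eq0; apply/eqP.
  exists (`|x|^-1 *: x) => _; split.
  - rewrite ipZl ipZr ipN norm_iota -fmorphV theta_iota -rmorphXn -!rmorphM/=.
    have s0 : Num.sqrt (rdot x x) != 0.
      by apply: contra_neq nx => h; rewrite norm_iota h rmorph0.
    move: s0; set r := Num.sqrt _ => s0.
    have -> : r^-1 * (r^-1 * r ^+ 2) = 1 by field.
    by rewrite rmorph1.
  - by move=> f Pf t; rewrite ipZl xP// mulr0.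
  - by move=> i ia; rewrite ipZl xa// mulr0.
pose L := fix L n := if n is m.+1 then rcons (L m) (nxt (L m)) else [::].
pose h n := nxt (L n).
have LE n : L n = mkseq h n.
  by elim: n => //= n IH; rewrite {1}IH /mkseq -[n.+1]addn1 iotaD map_cat /= cats1.
have Lgood n : good (L n).
  elim: n => [|n IH] /=; first by split.
  have [y1 yP ya] := hnxt _ IH; case: IH => g1 g2.
  split=> [i j|i]; rewrite size_rcons !ltnS => hi.
    move=> hj; rewrite !nth_rcons.
    case: (ltngtP i (size (L n))) hi => // hi _; case: (ltngtP j (size (L n))) hj => // hj _.
    - by rewrite g1.
    - by rewrite hj (ltn_eqF hi); apply/ip0_sym/ya.
    - by rewrite hi (gtn_eqF hj); apply: ya.
    - by rewrite hi hj eqxx.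
  by rewrite nth_rcons; case: (ltngtP i (size (L n))) hi => // hi _; apply: g2.
have hP n : famperp Phi (h n) by have [] := hnxt _ (Lgood n).
apply: (maxPhi h) => // i j.
have [g1 _] := Lgood (maxn i j).+1.
have := g1 i j; rewrite LE size_mkseq !ltnS leq_maxl leq_maxr => /(_ isT isT).
by rewrite !nth_mkseq ?ltnS ?leq_maxl ?leq_maxr.
Qed.

(** The finitely many missing vectors are placed in front of the sequence e of one
of the families. *)
Lemma total_orthofam : ~ finite_dimensional H -> exists Phi, orthofam Phi /\
  forall x, famperp Phi x -> x = 0.
Proof.
move=> infH; have [Phi [oPhi maxPhi]] := maximal_orthofam; have [hon hoff] := oPhi.
have [a [a1 a2 a3]] := complete_orthofam maxPhi.
have [[f0 Pf0]|noPhi] := pselect (exists f, Phi f); last first.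
  case: infH; exists (size a), (fun i : 'I_(size a) => a`_i) => x.
  exists (fun i : 'I_(size a) => ip x a`_i).
  apply/eqP; rewrite -subr_eq0; apply/eqP/a3 => [f Pf|i ia].
    by case: noPhi; exists f.
  rewrite ipBl; have -> : ip (\sum_(i0 < size a) ip x a`_i0 *: a`_i0) a`_i =
      \sum_(i0 < size a) ip x a`_i0 * ip a`_i0 a`_i.
    elim/big_rec2: _ => [|j y1 y2 _ <-]; first by rewrite -(scale0r 0) ipZl mul0r.
    by rewrite ipDl ipZl.
  rewrite (bigD1 (Ordinal ia))//= a1// eqxx mulr1 big1 ?addr0 ?subrr// => j ji.
  by rewrite a1// (_ : (_ == _) = false) ?mulr0//; apply/negbTE.
pose d := size a.
pose f1 (t : T) := match t with
  | inl n => if (n < d)%N then a`_n else f0 (inl (n - d)%N)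
  | inr p => f0 (inr p) end.
have f1P t : (exists i, (i < d)%N /\ t = inl i /\ f1 t = a`_i) \/
    (exists s, f1 t = f0 s /\ t = match s with inl n => inl (n + d)%N | inr p => inr p end).
  case: t => [n|p]; last by right; exists (inr p).
  have [nd|dn] := ltnP n d; first by left; exists n; rewrite /f1 nd.
  by right; exists (inl (n - d)%N); rewrite /f1 ltnNge dn subnK.
have f1g g : Phi g -> g <> f0 -> forall s t, ip (g s) (f1 t) = 0.
  move=> Pg gf s t; have [[i [id [_ ->]]]|[s' [-> _]]] := f1P t.
    exact/ip0_sym/a2.
  exact: hoff.
have f1_on s t : ip (f1 s) (f1 t) = (s == t)%:R.
  have [[i [id [-> ->]]]|[s' [-> ->]]] := f1P s;
    have [[j [jd [-> ->]]]|[t' [-> ->]]] := f1P t.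
  - by rewrite a1.
  - rewrite a2//; case: t' => [n|p] //; rewrite (_ : (_ == _) = false)//.
    by apply/eqP => -[ij]; move: id; rewrite ij ltnNge leq_addl.
  - rewrite ip0_sym ?a2//; case: s' => [n|p] //; rewrite (_ : (_ == _) = false)//.
    by apply/eqP => -[ij]; move: jd; rewrite -ij ltnNge leq_addl.
  - rewrite hon//; case: s' => [n|p]; case: t' => [m|q] //; congr (nat_of_bool _)%:R.
    by apply/eqP/eqP => [[->]//|[/addIn ->]].
exists ([set g | Phi g /\ g <> f0] `|` [set f1]); split.
  split=> [g [[Pg _]|->//]|g g' [[Pg gf]|->] [[Pg' gf']|->] gg' s t].
  - exact: hon.
  - exact: hoff.
  - exact: f1g.
  - exact/ip0_sym/f1g.
  - by [].
move=> x hx; apply: a3 => [g Pg t|i ia].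
  have [gf|gf] := pselect (g = f0); last by apply: hx; left.
  rewrite gf; have xf1 := hx f1 (or_intror erefl).
  case: t => [n|p]; last exact: (xf1 (inr p)).
  by have := xf1 (inl (n + d)%N); rewrite /f1 ltnNge leq_addl /= addnK.
have := hx f1 (or_intror erefl) (inl i).
by rewrite /f1 ia.
Qed.

End Families.

(** The interface (iota, re, theta) covers both scalar fields: iota embeds the
reals, re is the real part and theta the conjugation. *)
Theorem three_subspaces : ~ finite_dimensional H ->
  exists X : 'I_3 -> set H, (forall i, closed_subspace (X i)) /\
    forall w0 : H, w0 != 0 -> exists s : nat -> 'I_3, ~ cvgn (iterates ip X s w0).
Proof.
move=> infH.
have [k [al [be [eps [[circ al0 be0 alk bek] [k1 al1 be1] eps0 eps_sum slow]]]]] := slow_paths R.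
have [Phi [[on off] tot]] := total_orthofam k infH.
pose T := label k.
pose span (f : T -> H) : set RH := cspan D (range f).
have /choice[F hF] : forall f : T -> H,
  exists F : 'I_3 -> set H, Phi f -> (forall j, F j `<=` span f) /\
  forall X : 'I_3 -> set RH, (forall j, csub D (X j)) ->
    (forall j, X j `<=` perp D (F j)) ->
    (forall j, span f `&` perp D (F j) `<=` X j) ->
    forall x y, stable D X x -> span f y -> D x y = 0.
  move=> f; have [Pf|nPf] := pselect (Phi f); last by exists (fun=> set0).
  have f_on s t : D (f s : RH) (f t : RH) = (s == t)%:R.
    by rewrite /= /rdot on//; case: eqP; rewrite ?re1 ?re0.
  have [F [F1 F2]] := stable_perp_family circ al0 be0 alk bek k1 al1 be1 eps0 eps_sum slow f_on.
  by exists F.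
pose C j := [set c | exists2 f, Phi f & F f j c].
exists (fun j => kperp (C j)); split=> [j|w0 w00]; first exact: kperp_closed.
apply: contrapT => conv; move/eqP: w00; apply.
have {}conv s : cvgn (iterates ip (fun j => kperp (C j)) s w0).
  by apply: contrapT => h; apply: conv; exists s.
have st a : stable D (fun j => kperp (C j)) (a *: w0).
  move=> s; have -> : orbit (fun j => proj D (kperp (C j))) s (a *: w0) =
      (fun n => a *: iterates ip (fun j => kperp (C j)) s w0 n).
    by apply/funext => n; rewrite -iterates_orbit iteratesZ.
  by apply: cvgn_is_cauchy; apply: is_cvgZr.
(* The next two facts make K-orthogonality to a constraint of any family follow
   from real orthogonality to the constraints of f. *)
have span_off f g c t : Phi f -> Phi g -> f <> g -> span g c -> ip c (f t) = 0.
  move=> Pf Pg fg gc; apply: nondeg => a.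
  have hp : perp D (range g : set RH) (a *: f t).
    by move=> _ [s _ <-]; rewrite /= /rdot ipZl off// mulr0.
  by have := perp_cspan hp gc; rewrite dotC.
have span_on f c t a : Phi f -> span f c -> re a = 0 -> re (a * ip c (f t)) = 0.
  move=> Pf fc a0.
  have hp : perp D (range f : set RH) (theta a *: f t).
    move=> _ [s _ <-]; rewrite /= /rdot ipZl on// -re_theta rmorphM.
    by case: eqP => _; rewrite ?rmorph1 ?rmorph0 ?mulr1 ?mulr0// !re_theta.
  have := perp_cspan hp fc; rewrite /= /rdot ipZl => h.
  by rewrite -re_theta rmorphM -ipC.
apply: tot => f Pf t; apply: nondeg => a.
have [FS comp] := hF f Pf.
rewrite ipZr -ipZl.
apply: (comp (fun j => kperp (C j))) (st _) _ => [j|j x hx c Fc|j x [fx xF]|].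
- exact: csub_kperp.
- by rewrite /= /rdot hx//; exists f.
- move=> c [g Pg Gc]; apply: nondeg => b.
  have [gS _] := hF g Pg; have gc := gS _ _ Gc.
  case: (pselect (f = g)) => fg; last first.
    apply: (fx (b *: c : H)) => _ [s _ <-].
    by rewrite /= /rdot ipZl (span_off f g)// mulr0 re0.
  (* The imaginary part b' of b contributes nothing, by [span_on]. *)
  subst g; pose b' := b - iota (re b).
  have b'0 : re b' = 0.
    by rewrite /b' reD -rmorphN re_iota subrr.
  have -> : b *: c = iota (re b) *: c + b' *: c by rewrite -scalerDl /b' addrC subrK.
  have h1 : re (ip x (b' *: c)) = 0.
    apply: (fx (b' *: c : H)) => _ [s _ <-].
    by rewrite /= /rdot ipZl span_on.
  have h2 : re (ip x c) = 0 by apply: (xF c Gc).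
  by rewrite ipC ipDl rmorphD -!ipC reD h1 ipZr theta_iota reZ h2 mulr0 addr0.
- by apply: cspan_gen; exists t.
Qed.

End Glue.

Theorem theorem3p5 (R : realType) :
  (forall (H : completeNormedModType R) (ip : {dot H for idfun}),
     induces_norm ip -> ~ finite_dimensional H ->
     exists X : 'I_3 -> set H,
       (forall i : 'I_3, closed_subspace (X i)) /\
       (forall w0 : H, w0 != 0 ->
          exists k : nat -> 'I_3, ~ cvgn (iterates ip X k w0))) /\
  (forall (H : completeNormedModType R[i]) (ip : {dot H for Num.conj}),
     induces_norm ip -> ~ finite_dimensional H ->
     exists X : 'I_3 -> set H,
       (forall i : 'I_3, closed_subspace (X i)) /\
       (forall w0 : H, w0 != 0 ->
          exists k : nat -> 'I_3, ~ cvgn (iterates ip X k w0))).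
Proof.
split=> H ip ipN infH.
  apply: (@three_subspaces R R [the {rmorphism R -> R} of idfun] idfun
    [the {rmorphism R -> R} of idfun] _ _ _ _ _ _ _ _ H ip ipN infH) => //=.
  by move=> x; rewrite real_normK ?num_real// expr2.
have T := @three_subspaces R R[i] [the {rmorphism R -> R[i]} of real_complex R] (@complex.Re R)
  [the {rmorphism R[i] -> R[i]} of Num.conj] _ _ _ _ _ _ _ _ H ip ipN infH.
apply: T => //=.
- by move=> [a b] [c d].
- by move=> r [a b] /=; rewrite mul0r subr0.
- by move=> [a b].
- by move=> r; apply: conj_Creal; rewrite complex_real.
- by move=> x; rewrite normCKC.
- by move=> x x0; apply: RRe_real; apply: ger0_real.
- by move=> r s; rewrite lecR.
Qed.
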